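(* Let $u(x,\rho)=\rho+v(x)\rho^2+w(x)\rho^3+z(x)\rho^4+l(x)\rho^5\log\rho+h(x)\rho^5+O(\rho^6)$ be a formal solution to the singular CR Yamabe problem near nonsingular points $x$ of $\Sigma=\partial M$. Then on $\Sigma$ $$\begin{aligned}12z=\;&3e_1e_1(v)-12V(\alpha)-\tfrac34e_2(R)+\tfrac{15}2Rv+18\alpha e_1(v)+56ve_1(\alpha)+264v^3+40\alpha^2v\\&-6a_1\alpha-10a_2v-6e_1(a_1)+3e_2(a_2).\end{aligned}$$
   Context: Pseudohermitian notation. $(M,J,\theta)$ is a 3-dimensional pseudohermitian manifold with boundary $\Sigma=\partial M$: $\theta$ is a contact form, $\xi=\ker\theta$, $J:\xi\to\xi$, $J^2=-\mathrm{Id}$, Levi metric $\frac12d\theta(\cdot,J\cdot)$ positive definite on $\xi$; $T$ is the Reeb field; $g_\theta=\langle\cdot,\cdot\rangle=\theta\otimes\theta+\frac12d\theta(\cdot,J\cdot)$; $\nabla$ is the Tanaka--Webster connection with torsion $T_\nabla$. For an orthonormal frame $e_1,e_2=Je_1$ of $\xi$ the real 1-form $\omega$ is given by $\nabla e_1=\omega\otimes e_2$, $\nabla e_2=-\omega\otimes e_1$; $a_1,a_2$ are given by $T_\nabla(T,e_1)=a_1e_1-a_2e_2$, $T_\nabla(T,e_2)=-a_2e_1-a_1e_2$; $W$ is the Webster curvature, $d\omega(e_1,e_2)=-2W$, and $R=2W$. Frame and defining function. A point $x\in\Sigma$ is nonsingular if $T_x\Sigma\neq\xi_x$. At such $x$,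 $e_1$ is a unit vector in $T_x\Sigma\cap\xi_x$ and $e_2=Je_1$, with sign chosen so that $\langle e_2,\nu\rangle>0$, $\nu$ the unit inner normal; $\alpha$ is defined by $V:=T+\alpha e_2\in T\Sigma$. Let $\gamma(\rho)=\exp_x(\rho e_2)$ be the solution of $\nabla_{\dot\gamma}\dot\gamma=0$, $\gamma(0)=x$, $\dot\gamma(0)=e_2$. The function $\rho$ is defined near nonsingular points by $\rho(\exp_x(\rho e_2))=\rho$; functions are written as $u(x,\rho)=u(\exp_x(\rho e_2))$. The frame is extended by $e_2:=\dot\gamma=\partial_\rho$, $e_1:=-Je_2$ (so $\omega(e_2)=0$); $a_1,a_2$ are taken with respect to this extended frame. Formal solution. Put $\triangle_Pu=e_1e_1(u)+e_2e_2(u)-\omega(e_1)e_2(u)+\omega(e_2)e_1(u)$ and $|d_Pu|^2=e_1(u)^2+e_2(u)^2$. The singular CR Yamabe problem asks for $u>0$ inside $M$, $u=0$ on $\Sigma$, such that $u^{-2}\theta$ has Webster curvature $-4$. A formal solution is a function $u$, positive for $\rho>0$ small, with an expansion (differentiable term by term, smooth coefficients on the nonsingular part of $\Sigma$) $u=c(x)\rho+v(x)\rho^2+w(x)\rho^3+z(x)\rho^4+l(x)\rho^5\log\rho+h(x)\rho^5+O(\rho^6)$ satisfying $|d_Pu|^2-\frac12u\triangle_Pu-\frac18Ru^2=1+O(\rho^5\log\rho)$; then $c\equiv1$. *)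

(* Defs.v *)
From mathcomp Require Import all_boot all_order all_algebra.
From mathcomp Require Import all_classical all_reals all_analysis.
Set Implicit Arguments.
Unset Strict Implicit.
Unset Printing Implicit Defensive.
Import Order.TTheory GRing.Theory Num.Theory.
Import numFieldNormedType.Exports.
Local Open Scope classical_set_scope.
Local Open Scope ring_scope.

Definition halfspace (R : realType) : set 'rV[R]_3 :=
  [set y | 0 <= y ord0 ord0].

Definition partial (R : realType) (i : 'I_3) (F : 'rV[R]_3 -> R) :
  'rV[R]_3 -> R := fun y => 'D_(delta_mx ord0 i) F y.

(* C^oo on an open set: every iterated partial derivative is differentiable. *)
Definition smooth3 (R : realType) (O : set 'rV[R]_3) (F : 'rV[R]_3 -> R) :=
  forall (s : seq 'I_3) (y : 'rV[R]_3), O y ->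
    differentiable (foldr (@partial R) F s) y.

(* A homeomorphism from the open set [cdom] onto a relatively open subset of
   the half-space; its values outside [cdom] are irrelevant. *)
Record chart (R : realType) (M : topologicalType) := Chart {
  cdom : set M;
  cmap :> M -> 'rV[R]_3;
  cdom_open : open cdom;
  cmap_inj : forall p q, cdom p -> cdom q -> cmap p = cmap q -> p = q;
  cmap_continuous : {within cdom, continuous cmap};
  cmap_open : forall A : set M, open A -> A `<=` cdom ->
    exists2 O : set 'rV[R]_3, open O & cmap @` A = O `&` @halfspace R }.

(* Smoothness up to the boundary: read in the chart, [f] is near [c p] the
   restriction of a smooth function defined on an open subset of R^3. *)
Definition extends_in (R : realType) (M : topologicalType) (c : chart R M)
    (f : M -> R) (p : M) (O : set 'rV[R]_3) (F : 'rV[R]_3 -> R) :=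
  [/\ open O, O (c p), smooth3 O F & \forall q \near p, f q = F (c q)].

Definition smooth_in (R : realType) (M : topologicalType) (c : chart R M)
    (f : M -> R) (p : M) := exists O F, extends_in c f p O F.

Record bmanifold3 (R : realType) := BManifold3 {
  carrier :> topologicalType;
  atlas : set (chart R carrier);
  bm_hausdorff : hausdorff_space carrier;
  bm_second_countable : @second_countable carrier;
  atlas_cover : forall p : carrier, exists2 c, atlas c & cdom c p;
  atlas_compat : forall (c c' : chart R carrier) (p : carrier),
    atlas c -> atlas c' -> cdom c p -> cdom c' p ->
    forall i : 'I_3, smooth_in c (fun q => c' q ord0 i) p }.

Definition boundary (R : realType) (M : bmanifold3 R) : set M :=
  [set p | exists c, [/\ atlas c, cdom c p & c p ord0 ord0 = 0]].

Definition smooth_at (R : realType) (M : bmanifold3 R) (f : M -> R) (p : M) :=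
  forall c, atlas c -> cdom c p -> smooth_in c f p.

Definition smooth_on (R : realType) (M : bmanifold3 R) (U : set M)
  (f : M -> R) := forall p, U p -> smooth_at f p.

(* Vector fields are represented by their action on functions; the value of
   [X f] at [p] is meaningful only if [f] is smooth near [p] and [p] lies in the
   open set on which [X] is a vector field. *)
Definition op (R : realType) (M : bmanifold3 R) := (M -> R) -> M -> R.

(* [X] has smooth components in each chart. At a boundary point the partial
   derivatives of the extension [F] depend only on [f]. *)
Definition vfield (R : realType) (M : bmanifold3 R) (U : set M) (X : op M) :=
  forall c, atlas c -> exists b : 'I_3 -> M -> R,
    (forall i, smooth_on (U `&` cdom c) (b i)) /\
    (forall (f : M -> R) (p : M) O F, U p -> cdom c p ->
       extends_in c f p O F ->
       X f p = \sum_(i < 3) b i p * partial i F (c p)).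

Definition veq (R : realType) (M : bmanifold3 R) (U : set M) (X Y : op M) :=
  forall p, U p -> forall f, smooth_at f p -> X f p = Y f p.

Definition vadd (R : realType) (M : bmanifold3 R) (X Y : op M) : op M :=
  fun f p => X f p + Y f p.
Definition vopp (R : realType) (M : bmanifold3 R) (X : op M) : op M :=
  fun f p => - X f p.
Definition vscale (R : realType) (M : bmanifold3 R) (a : M -> R) (X : op M) :
  op M := fun f p => a p * X f p.
Definition vzero (R : realType) (M : bmanifold3 R) : op M := fun f p => 0.
Definition bracket (R : realType) (M : bmanifold3 R) (X Y : op M) : op M :=
  fun f p => X (Y f) p - Y (X f) p.

(* 1-forms on the open set [U]: C^oo-linear maps on the vector fields over the
   open subsets of [U]; the last clause, applied on small open sets, makes
   [eta X p] depend only on [X] near [p]. *)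
Record is_form (R : realType) (M : bmanifold3 R) (U : set M)
    (eta : op M -> M -> R) : Prop := IsForm {
  form_smooth : forall O X, open O -> O `<=` U -> vfield O X ->
    smooth_on O (eta X);
  form_linear : forall O X Y a, open O -> O `<=` U -> vfield O X ->
    vfield O Y -> smooth_on O a ->
    forall p, O p -> eta (vadd (vscale a X) Y) p = a p * eta X p + eta Y p;
  form_congr : forall O X Y, open O -> O `<=` U -> vfield O X -> vfield O Y ->
    veq O X Y -> forall p, O p -> eta X p = eta Y p }.

Definition dform (R : realType) (M : bmanifold3 R) (eta : op M -> M -> R)
    (X Y : op M) : M -> R :=
  fun p => X (eta Y) p - Y (eta X) p - eta (bracket X Y) p.

Definition horizontal (R : realType) (M : bmanifold3 R) (theta : op M -> M -> R)
    (O : set M) (X : op M) :=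
  vfield O X /\ forall p, O p -> theta X p = 0.

(* [J] is only meaningful on sections of the contact bundle [ker theta]. *)
Record pseudohermitian (R : realType) (M : bmanifold3 R) := Pseudohermitian {
  theta : op M -> M -> R;
  Jop : op M -> op M;
  theta_form : is_form setT theta;
  theta_contact : forall p, exists O X Y Z,
    [/\ open O, O p, vfield O X, vfield O Y & vfield O Z] /\
    theta X p * dform theta Y Z p + theta Y p * dform theta Z X p
      + theta Z p * dform theta X Y p <> 0;
  J_horizontal : forall O X, open O -> horizontal theta O X ->
    horizontal theta O (Jop X);
  J_linear : forall O X Y a, open O -> horizontal theta O X ->
    horizontal theta O Y -> smooth_on O a ->
    veq O (Jop (vadd (vscale a X) Y)) (vadd (vscale a (Jop X)) (Jop Y));
  J_congr : forall O X Y, open O -> horizontal theta O X ->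
    horizontal theta O Y -> veq O X Y -> veq O (Jop X) (Jop Y);
  J_square : forall O X, open O -> horizontal theta O X ->
    veq O (Jop (Jop X)) (vopp X);
  levi_pos : forall O X p, open O -> horizontal theta O X -> O p ->
    (exists2 f, smooth_at f p & X f p <> 0) ->
    0 < 2^-1 * dform theta X (Jop X) p }.

Record is_reeb (R : realType) (M : bmanifold3 R) (S : pseudohermitian M)
    (T : op M) : Prop := IsReeb {
  reeb_vfield : vfield setT T;
  reeb_theta : forall p, theta S T p = 1;
  reeb_dtheta : forall O X, open O -> vfield O X ->
    forall p, O p -> dform (theta S) T X p = 0 }.

(* In [gmetric], [J] is extended to all vector fields by [J T = 0]. *)
Definition hpart (R : realType) (M : bmanifold3 R) (S : pseudohermitian M)
    (T X : op M) : op M :=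
  vadd X (vopp (vscale (theta S X) T)).
Definition gmetric (R : realType) (M : bmanifold3 R) (S : pseudohermitian M)
    (T X Y : op M) : M -> R :=
  fun p => theta S X p * theta S Y p
    + 2^-1 * dform (theta S) (hpart S T X) (Jop S (hpart S T Y)) p.

Record is_connection (R : realType) (M : bmanifold3 R)
    (nabla : op M -> op M -> op M) : Prop := IsConnection {
  conn_vfield : forall O X Y, open O -> vfield O X -> vfield O Y ->
    vfield O (nabla X Y);
  conn_congr : forall O X X' Y Y', open O -> vfield O X -> vfield O X' ->
    vfield O Y -> vfield O Y' -> veq O X X' -> veq O Y Y' ->
    veq O (nabla X Y) (nabla X' Y');
  conn_linear : forall O X X' Y a, open O -> vfield O X -> vfield O X' ->
    vfield O Y -> smooth_on O a ->
    veq O (nabla (vadd (vscale a X) X') Y)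
          (vadd (vscale a (nabla X Y)) (nabla X' Y));
  conn_leibniz : forall O X Y Y' a, open O -> vfield O X -> vfield O Y ->
    vfield O Y' -> smooth_on O a ->
    veq O (nabla X (vadd (vscale a Y) Y'))
          (vadd (vadd (vscale (X a) Y) (vscale a (nabla X Y))) (nabla X Y')) }.

Definition torsion (R : realType) (M : bmanifold3 R)
    (nabla : op M -> op M -> op M) (X Y : op M) : op M :=
  fun f p => nabla X Y f p - nabla Y X f p - bracket X Y f p.

Record is_tanaka_webster (R : realType) (M : bmanifold3 R)
    (S : pseudohermitian M) (T : op M) (nabla : op M -> op M -> op M) : Prop :=
  IsTanakaWebster {
  tw_connection : is_connection nabla;
  tw_horizontal : forall O X Y, open O -> vfield O X ->
    horizontal (theta S) O Y -> horizontal (theta S) O (nabla X Y);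
  tw_reeb : forall O X, open O -> vfield O X -> veq O (nabla X T) (@vzero R M);
  tw_J : forall O X Y, open O -> vfield O X -> horizontal (theta S) O Y ->
    veq O (nabla X (Jop S Y)) (Jop S (nabla X Y));
  tw_metric : forall O X Y Z, open O -> vfield O X -> vfield O Y ->
    vfield O Z -> forall p, O p ->
    Z (gmetric S T X Y) p
      = gmetric S T (nabla Z X) Y p + gmetric S T X (nabla Z Y) p;
  tw_torsion_xi : forall O X Y, open O -> horizontal (theta S) O X ->
    horizontal (theta S) O Y ->
    veq O (torsion nabla X Y) (vscale (dform (theta S) X Y) T);
  tw_torsion_T : forall O X, open O -> horizontal (theta S) O X ->
    veq O (torsion nabla T (Jop S X)) (vopp (Jop S (torsion nabla T X))) }.

(* The value of [X] at the boundary point [p] lies in the tangent plane of the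
   boundary. *)
Definition tangent_at (R : realType) (M : bmanifold3 R) (X : op M) (p : M) :=
  forall f, smooth_at f p -> (\forall q \near p, boundary q -> f q = 0) ->
    X f p = 0.

Definition nonsingular (R : realType) (M : bmanifold3 R)
    (S : pseudohermitian M) (p : M) :=
  boundary p /\
  ~ (forall O X, open O -> O p -> vfield O X ->
       (tangent_at X p <-> theta S X p = 0)).

Record unit_inner_normal (R : realType) (M : bmanifold3 R)
    (S : pseudohermitian M) (T N : op M) (p : M) : Prop := UnitInnerNormal {
  normal_vfield : exists O, [/\ open O, O p & vfield O N];
  normal_orthogonal : forall O X, open O -> O p -> vfield O X ->
    tangent_at X p -> gmetric S T N X p = 0;
  normal_unit : gmetric S T N N p = 1;
  normal_inner : forall f, smooth_at f p ->
    (\forall q \near p, 0 <= f q /\ (boundary q -> f q = 0)) -> 0 <= N f p }.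

(* [expn x s], for [0 <= s < len x], stands for [exp_x (s e2)]. As [e2] is the
   extended field, equal to the velocity of these curves ([af_velocity], with
   one-sided derivative at [s = 0]), the equation [af_geodesic] says that they
   are geodesics. [af_cover] says that [U] is swept out by them. *)
Record adapted_frame (R : realType) (M : bmanifold3 R)
    (S : pseudohermitian M) (T : op M) (nabla : op M -> op M -> op M)
    (U : set M) (e1 e2 : op M) (rho : M -> R) (expn : M -> R -> M)
    (len : M -> R) : Prop := AdaptedFrame {
  af_open : open U;
  af_nonsingular : forall x, U x -> boundary x -> nonsingular S x;
  af_e1 : horizontal (theta S) U e1;
  af_e2 : horizontal (theta S) U e2;
  af_J : veq U (Jop S e1) e2;
  af_unit : forall p, U p -> gmetric S T e1 e1 p = 1;
  af_tangent : forall x, U x -> boundary x -> tangent_at e1 x;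
  af_inner : forall x, U x -> boundary x ->
    exists2 N, unit_inner_normal S T N x & 0 < gmetric S T e2 N x;
  af_len : forall x, U x -> boundary x -> 0 < len x;
  af_start : forall x, U x -> boundary x -> expn x 0 = x;
  af_stay : forall x s, U x -> boundary x -> 0 <= s < len x -> U (expn x s);
  af_velocity : forall x s f, U x -> boundary x -> 0 <= s < len x ->
    smooth_at f (expn x s) ->
    (t - s)^-1 * (f (expn x t) - f (expn x s))
      @[t --> within [set t | 0 <= t < len x] s^'] --> e2 f (expn x s);
  af_geodesic : veq U (nabla e2 e2) (@vzero R M);
  af_cover : forall q, U q ->
    exists x s, [/\ U x, boundary x, 0 <= s < len x & q = expn x s];
  af_rho : forall x s, U x -> boundary x -> 0 <= s < len x ->
    rho (expn x s) = s;
  af_rho_smooth : smooth_on U rho }.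

Record is_connection_form (R : realType) (M : bmanifold3 R)
    (nabla : op M -> op M -> op M) (U : set M) (e1 e2 : op M)
    (omega : op M -> M -> R) : Prop := IsConnectionForm {
  cf_form : is_form U omega;
  cf_e1 : forall O X, open O -> O `<=` U -> vfield O X ->
    veq O (nabla X e1) (vscale (omega X) e2);
  cf_e2 : forall O X, open O -> O `<=` U -> vfield O X ->
    veq O (nabla X e2) (vopp (vscale (omega X) e1)) }.

Definition torsion_coefficients (R : realType) (M : bmanifold3 R) (T : op M)
    (nabla : op M -> op M -> op M) (U : set M) (e1 e2 : op M)
    (a1 a2 : M -> R) :=
  veq U (torsion nabla T e1) (vadd (vscale a1 e1) (vopp (vscale a2 e2))) /\
  veq U (torsion nabla T e2)
        (vadd (vopp (vscale a2 e1)) (vopp (vscale a1 e2))).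

Definition webster_curvature (R : realType) (M : bmanifold3 R) (U : set M)
    (e1 e2 : op M) (omega : op M -> M -> R) (W : M -> R) :=
  forall p, U p -> dform omega e1 e2 p = - (2 * W p).

Definition Vfield (R : realType) (M : bmanifold3 R) (T e2 : op M)
    (alpha : M -> R) : op M := vadd T (vscale alpha e2).

(* [alpha], a function on the boundary, is represented by an arbitrary smooth
   extension. *)
Definition is_alpha (R : realType) (M : bmanifold3 R) (T : op M) (U : set M)
    (e2 : op M) (alpha : M -> R) :=
  smooth_on U alpha /\
  forall x, U x -> boundary x -> tangent_at (Vfield T e2 alpha) x.

Definition dP_normsq (R : realType) (M : bmanifold3 R) (e1 e2 : op M)
    (u : M -> R) : M -> R := fun p => e1 u p ^+ 2 + e2 u p ^+ 2.

Definition laplP (R : realType) (M : bmanifold3 R) (e1 e2 : op M)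
    (omega : op M -> M -> R) (u : M -> R) : M -> R :=
  fun p => e1 (e1 u) p + e2 (e2 u) p - omega e1 p * e2 u p
             + omega e2 p * e1 u p.

(* A smooth function of the boundary point [x], viewed as a function of
   [(x, rho)] that does not depend on [rho]. *)
Definition boundary_coefficient (R : realType) (M : bmanifold3 R) (U : set M)
    (expn : M -> R -> M) (len : M -> R) (c : M -> R) :=
  smooth_on U c /\
  forall x s, U x -> boundary x -> 0 <= s < len x -> c (expn x s) = c x.

Definition expansion (R : realType) (M : bmanifold3 R)
    (rho v w z l h : M -> R) : M -> R :=
  fun q => rho q + v q * rho q ^+ 2 + w q * rho q ^+ 3 + z q * rho q ^+ 4
    + l q * rho q ^+ 5 * ln (rho q) + h q * rho q ^+ 5.

(* [r = O(rho^6)] locally uniformly near [x], differentiably: a derivative along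
   [e2 = d/drho] costs one power of [rho], and a derivative along a field
   annihilating [rho] (that is, in the variables [x] at fixed [rho]) costs
   none. *)
Definition big_O_rho6 (R : realType) (M : bmanifold3 R) (U : set M)
    (e2 : op M) (rho r : M -> R) (x : M) :=
  forall (Xs : seq (op M)) (b : nat),
    (forall k, (k < size Xs)%N ->
       vfield U (nth (@vzero R M) Xs k) /\
       forall q, U q -> nth (@vzero R M) Xs k rho q = 0) ->
    exists C : R, \forall q \near x, 0 < rho q ->
      `| foldr (fun X f => X f) (iter b e2 r) Xs q |
        <= C * rho q ^ (6%:Z - b%:Z).

Record formal_solution (R : realType) (M : bmanifold3 R) (U : set M)
    (e1 e2 : op M) (rho : M -> R) (expn : M -> R -> M) (len : M -> R)
    (omega : op M -> M -> R) (Rc : M -> R) (u v w z l h : M -> R) : Prop :=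
  FormalSolution {
  fs_positive : forall x, U x -> boundary x ->
    \forall q \near x, 0 < rho q -> 0 < u q;
  fs_zero : forall x, U x -> boundary x -> u x = 0;
  fs_smooth : forall x, U x -> boundary x ->
    \forall q \near x, 0 < rho q -> smooth_at u q;
  fs_coefficients : [/\ boundary_coefficient U expn len v,
    boundary_coefficient U expn len w, boundary_coefficient U expn len z,
    boundary_coefficient U expn len l & boundary_coefficient U expn len h];
  fs_expansion : forall x, U x -> boundary x ->
    big_O_rho6 U e2 rho (fun q => u q - expansion rho v w z l h q) x;
  fs_equation : forall x, U x -> boundary x ->
    exists C : R, \forall q \near x, 0 < rho q ->
      `| dP_normsq e1 e2 u q - 2^-1 * (u q * laplP e1 e2 omega u q)
          - 8^-1 * (Rc q * u q ^+ 2) - 1 |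
        <= C * (rho q ^+ 5 * `| ln (rho q) |) }.

(* Main.v *)
Require Import Defs.
From mathcomp Require Import all_boot all_order all_algebra.
From mathcomp Require Import all_classical all_reals all_analysis.
From mathcomp Require Import ring.
Set Implicit Arguments.
Unset Strict Implicit.
Unset Printing Implicit Defensive.
Import Order.TTheory GRing.Theory Num.Theory.
Import numFieldNormedType.Exports.
Local Open Scope classical_set_scope.
Local Open Scope ring_scope.

(** The coefficient [z] is found by differentiating the equation three times
    along the geodesics transverse to the boundary. Put [P = rho + v rho^2 +
    w rho^3 + z rho^4], so that [u = P + l rho^5 log rho + h rho^5 + O(rho^6)].
    The remainder [u - P] and its first derivatives are [o(rho^3)], its second
    derivatives [o(rho^2)] ([remainder_asym]); since the equation is quadratic and
    the second derivatives are multiplied by [u = O(rho)], replacing [u] by [P]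
    changes its left-hand side by [o(rho^3)] only ([asym_defect_P]). The defect of
    [P] in the equation is therefore a smooth function that is [o(rho^3)], and as
    [e2] is the derivative along the geodesics, its derivatives along [e2] of
    order at most three vanish on the boundary ([defect_polynomial_part]).

    What remains is the algebra of the frame. The values at a boundary point of
    the first three [e2]-derivatives of a product depend only on those of the
    factors, so the derivatives of the defect follow from those of [e1 rho],
    [e1 (e1 rho)], [omega e1] and the curvature ([jet_defect]). Writing
    [f = e1 rho], [g = T rho], [A = omega e1], the commutators of [e1], [e2], [T]
    (which the torsion of the connection prescribes) applied to [rho], with
    [e2 rho = 1], give
      [e2 f = A f + 2 g] and [e2 g = (omega T - a2) f - a1],
    the curvature gives [e2 A = Rc + A^2 + 2 omega T], and the Jacobi identity
    gives [e2 (omega T)]. On the boundary [rho], [f] and [g + alpha] vanish, and so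
    do their derivatives along [e1] and [V = T + alpha e2], which are tangent; this
    evaluates all the remaining terms. The first derivative of the defect then
    says [A = - 6 v] on the boundary, the second determines [w], and the third
    determines [z].

    The objects are given by their action on smooth functions, so the proof first
    shows that vector fields are derivations preserving smoothness, up to the
    boundary and independently of the charts, and that brackets of vector fields
    are vector fields (by symmetry of second derivatives). Forms have to be shown
    to be tensorial: this is what makes [e1], [e2] independent at each point
    ([form_bracket_eq0], [e1_horizontal_neq0]), hence [a1] and [a2] smooth
    ([smooth_a1_a2]) and [omega e2 = 0]. *)

(** * Smooth functions on R^3 *)

Lemma near_eq_differentiable (K : numFieldType) (V W : normedModType K)
    (f g : V -> W) (x : V) :
  (\near x, f x = g x) -> differentiable f x -> differentiable g x.
Proof.
move=> fg df.
have fgx : f x = g x := nbhs_singleton fg.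
have cd : continuous ('d f x) := diff_continuous df.
have E : g \o shift x = cst (g x) + 'd f x +o_ 0 id.
  apply/eqaddoP => _/posnumP[e].
  have /diff_locally/eqaddoP/(_ e%:num) := df; move=> /(_ [gt0 of e%:num]).
  have : \forall h \near (0 : V), f (h + x) = g (h + x).
    by move: fg; rewrite (near_shift 0) subr0.
  apply: filterS2 => h fgh.
  by rewrite -![(_ + _ : _ -> _) _]/(_ + _) -![(- _ : _ -> _) _]/(- _) /= fgh /cst fgx.
by apply/diff_locallyP; rewrite (diff_unique cd E).
Qed.

Section Smooth3.
Variable R : realType.
Implicit Types (O : set 'rV[R]_3) (F G H : 'rV[R]_3 -> R) (y : 'rV[R]_3).

(** Smoothness of finite order: unlike the condition on all iterated derivatives,
    it lends itself to induction, since the derivatives of a product or of a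
    composite are again built from functions of one order less. *)
Fixpoint Ck n O F : Prop :=
  (forall y, O y -> differentiable F y) /\
  (if n is m.+1 then forall i, Ck m O (partial i F) else True).

Lemma smooth3P O F : smooth3 O F <-> forall n, Ck n O F.
Proof.
split=> [sF n|CF s].
  elim: n F sF => [|n IH] F sF; split=> //; try exact: (sF [::]).
  by move=> i; apply: IH => s y Oy; rewrite -foldr_rcons; exact: sF.
have {CF} : Ck (size s) O F by [].
elim/last_ind: s F => [|s i IH] F; first by case=> dF _ y; exact: dF.
by rewrite size_rcons foldr_rcons => -[_ /(_ i)]; exact: IH.
Qed.

Lemma Ck_partial n O F i : Ck n.+1 O F -> Ck n O (partial i F).
Proof. by case=> _; apply. Qed.

Lemma CkW n O F : Ck n.+1 O F -> Ck n O F.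
Proof.
elim: n F => [|n IH] F [dF pF]; split=> // i.
exact/IH/pF.
Qed.

Lemma partial_eq O F G i y : open O -> {in O, F =1 G} -> O y ->
  partial i F y = partial i G y.
Proof.
move=> oO FG Oy; apply: near_eq_derive.
have : nbhs y O by exact: open_nbhs_nbhs.
by apply: filterS => z Oz; apply: FG; rewrite inE.
Qed.

Lemma Ck_eq n O F G : open O -> {in O, F =1 G} -> Ck n O F -> Ck n O G.
Proof.
move=> oO; elim: n F G => [|n IH] F G FG [dF pF]; split=> //.
- move=> y Oy; apply: near_eq_differentiable (dF y Oy).
  have : nbhs y O by exact: open_nbhs_nbhs.
  by apply: filterS => z Oz; apply: FG; rewrite inE.
- move=> y Oy; apply: near_eq_differentiable (dF y Oy).
  have : nbhs y O by exact: open_nbhs_nbhs.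
  by apply: filterS => z Oz; apply: FG; rewrite inE.
move=> i; apply: IH (pF i) => y; rewrite inE => Oy.
exact: partial_eq Oy.
Qed.

(** The inductive step of all the closure properties below: the first partial
    derivatives only have to be identified on the open set. *)
Lemma CkS n O F (P : 'I_3 -> 'rV[R]_3 -> R) : open O ->
  (forall y, O y -> differentiable F y) ->
  (forall i y, O y -> partial i F y = P i y) ->
  (forall i, Ck n O (P i)) -> Ck n.+1 O F.
Proof.
move=> oO dF FP CP; split=> // i.
apply: Ck_eq (CP i) => // y; rewrite inE => Oy; exact/esym/FP.
Qed.

Lemma Ck_cst n O (a : R) : open O -> Ck n O (fun=> a).
Proof.
move=> oO; elim: n a => [|n IH] a; first by split=> // y _; exact: differentiable_cst.
apply: (@CkS n O _ (fun _ _ => 0)) => //.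
by move=> i y _; exact: derive_cst.
Qed.

Lemma partialD F G i y : differentiable F y -> differentiable G y ->
  partial i (fun z => F z + G z) y = partial i F y + partial i G y.
Proof. by move=> dF dG; apply: deriveD; exact: diff_derivable. Qed.

Lemma partialM F G i y : differentiable F y -> differentiable G y ->
  partial i (fun z => F z * G z) y = partial i F y * G y + F y * partial i G y.
Proof.
move=> dF dG; rewrite /partial deriveM; try exact: diff_derivable.
by rewrite addrC mulrC.
Qed.

Lemma partialV F i y : differentiable F y -> F y != 0 ->
  partial i (fun z => (F z)^-1) y = - partial i F y * ((F y)^-1 * (F y)^-1).
Proof.
move=> dF F0; rewrite /partial deriveV//; last exact: diff_derivable.
by rewrite scaleNr mulNr -expr2 exprVn mulrC.
Qed.

Lemma CkD n O F G : open O -> Ck n O F -> Ck n O G ->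
  Ck n O (fun y => F y + G y).
Proof.
move=> oO; elim: n F G => [|n IH] F G CF CG.
  by split=> // y Oy; apply: differentiableD; [exact: CF.1|exact: CG.1].
have [[dF pF] [dG pG]] := (CF, CG).
apply: (@CkS n O _ (fun i y => partial i F y + partial i G y)).
- exact: oO.
- by move=> y Oy; apply: differentiableD; [exact: dF|exact: dG].
- by move=> i y Oy; apply: partialD; [exact: dF|exact: dG].
- by move=> i; exact: IH (pF i) (pG i).
Qed.

Lemma CkM n O F G : open O -> Ck n O F -> Ck n O G ->
  Ck n O (fun y => F y * G y).
Proof.
move=> oO; elim: n F G => [|n IH] F G CF CG.
  by split=> // y Oy; apply: differentiableM; [exact: CF.1|exact: CG.1].
have [[dF pF] [dG pG]] := (CF, CG).
apply: (@CkS n O _ (fun i y => partial i F y * G y + F y * partial i G y)).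
- exact: oO.
- by move=> y Oy; apply: differentiableM; [exact: dF|exact: dG].
- by move=> i y Oy; apply: partialM; [exact: dF|exact: dG].
- move=> i; apply: CkD => //; first exact: IH (pF i) (CkW CG).
  exact: IH (CkW CF) (pG i).
Qed.

Lemma CkV n O F : open O -> (forall y, O y -> F y != 0) -> Ck n O F ->
  Ck n O (fun y => (F y)^-1).
Proof.
move=> oO F0; elim: n => [|n IH] CF.
  by split=> // y Oy; apply: differentiableV; [exact: CF.1|exact: F0].
have [dF pF] := CF.
apply: (@CkS n O _ (fun i y =>
  ((fun=> -1) y * partial i F y) * ((F y)^-1 * (F y)^-1))).
- exact: oO.
- by move=> y Oy; apply: differentiableV; [exact: dF|exact: F0].
- by move=> i y Oy; rewrite partialV ?mulN1r//; [exact: dF|exact: F0].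
- move=> i; have CV := IH (CkW CF).
  apply: (CkM oO _ (CkM oO CV CV)); exact: CkM oO (Ck_cst n (-1) oO) (pF i).
Qed.

Lemma partial_ln F i y : differentiable F y -> 0 < F y ->
  differentiable (fun z => ln (F z)) y /\
  partial i (fun z => ln (F z)) y = partial i F y * (F y)^-1.
Proof.
move=> dF F0; have D := is_derive1_ln F0.
have dln : differentiable (@ln R) (F y) by apply/derivable1_diffP.
split; first exact: (differentiable_comp dF dln).
rewrite /partial deriveE; last exact: (differentiable_comp dF dln).
rewrite (diff_comp dF dln) /= deriveE// deriv1E; last by apply/derivable1_diffP.
by rewrite derive1E derive_val.
Qed.

Lemma Ck_ln n O F : open O -> (forall y, O y -> 0 < F y) -> Ck n O F ->
  Ck n O (fun y => ln (F y)).
Proof.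
move=> oO F0; case: n => [|n] CF.
  by split=> // y Oy; case: (partial_ln ord0 (CF.1 y Oy) (F0 y Oy)).
have [dF pF] := CF.
apply: (@CkS n O _ (fun i y => partial i F y * (F y)^-1)).
- exact: oO.
- by move=> y Oy; case: (partial_ln ord0 (dF y Oy) (F0 y Oy)).
- by move=> i y Oy; case: (partial_ln i (dF y Oy) (F0 y Oy)).
- move=> i; apply: (CkM oO (Ck_partial i CF)); apply: (CkV oO _ (CkW CF)).
  by move=> y Oy; rewrite gt_eqF// F0.
Qed.

Lemma partial_coord i j y :
  partial i (fun z => z ord0 j) y = (i == j)%:R.
Proof.
have : derivable (id : 'rV[R]_3 -> _) y (delta_mx ord0 i) by exact: derivable_id.
move=> /derive_mx; rewrite derive_id => /matrixP/(_ ord0 j); rewrite !mxE eqxx /= => E.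
by rewrite /partial -E eq_sym.
Qed.

Lemma differentiable_row (G : 'I_3 -> 'rV[R]_3 -> R) y :
  (forall j, differentiable (G j) y) ->
  differentiable (fun z => \row_j G j z) y.
Proof.
move=> dG.
have -> : (fun z => \row_j G j z) =
    \sum_(j < 3) (fun z => G j z *: (delta_mx ord0 j : 'rV[R]_3)).
  apply/funext => z; rewrite fct_sumE; apply/rowP => j; rewrite !mxE summxE.
  rewrite (bigD1 j)//= !mxE !eqxx mulr1 big1 ?addr0// => k kj.
  by rewrite !mxE/= eq_sym (negbTE kj) mulr0.
by apply: differentiable_sum => j; exact: differentiableZl.
Qed.

(** The chain rule in coordinates, from which smoothness and vector fields will
    be seen not to depend on the chart. *)
Lemma partial_comp F (G : 'I_3 -> 'rV[R]_3 -> R) i y :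
  (forall j, differentiable (G j) y) ->
  differentiable F (\row_j G j y) ->
  differentiable (fun z => F (\row_j G j z)) y /\
  partial i (fun z => F (\row_j G j z)) y =
    \sum_(j < 3) partial j F (\row_j G j y) * partial i (G j) y.
Proof.
move=> dG dF.
pose g z := \row_j G j z.
have dg : differentiable g y := differentiable_row dG.
split; first exact: (differentiable_comp dg dF).
rewrite /partial deriveE; last exact: (differentiable_comp dg dF).
rewrite (diff_comp dg dF) /=.
have -> : 'd g y (delta_mx ord0 i) =
    \sum_(j < 3) 'D_(delta_mx ord0 i) (G j) y *: (delta_mx ord0 j : 'rV[R]_3).
  rewrite -deriveE// derive_mx; last exact: diff_derivable.
  apply/rowP => j; rewrite !mxE summxE.
  rewrite (bigD1 j)//= !mxE !eqxx mulr1 big1 ?addr0 => [|k kj].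
    by congr ('D__ _ _); apply/funext => z; rewrite mxE.
  by rewrite !mxE/= eq_sym (negbTE kj) mulr0.
rewrite linear_sum; apply: eq_bigr => j _.
by rewrite linearZ (deriveE (f := F)) // mulrC.
Qed.

Lemma Ck_sum n O (I : Type) (r : seq I) (F : I -> 'rV[R]_3 -> R) : open O ->
  (forall i, Ck n O (F i)) -> Ck n O (fun y => \sum_(i <- r) F i y).
Proof.
move=> oO CF; elim: r => [|i r IH].
  apply: Ck_eq (Ck_cst n 0 oO) => // y _; by rewrite big_nil.
apply: Ck_eq (CkD oO (CF i) IH) => // y _; by rewrite big_cons.
Qed.

Lemma Ck_comp n O O' F (G : 'I_3 -> 'rV[R]_3 -> R) : open O' ->
  (forall j, Ck n O' (G j)) -> (forall y, O' y -> O (\row_j G j y)) ->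
  Ck n O F -> Ck n O' (fun y => F (\row_j G j y)).
Proof.
move=> oO'; elim: n F => [|n IH] F CG OG CF.
  split=> // y O'y.
  have [|//|] := @partial_comp F G ord0 y; last by [].
    by move=> j; exact: (CG j).1.
  exact/CF.1/OG.
have dc i y : O' y -> differentiable (fun z => F (\row_j G j z)) y /\
  partial i (fun z => F (\row_j G j z)) y =
    \sum_(j < 3) partial j F (\row_j G j y) * partial i (G j) y.
  move=> O'y; apply: partial_comp => [j|]; first exact: (CG j).1.
  exact/CF.1/OG.
apply: (@CkS n O' _ (fun i y =>
  \sum_(j < 3) partial j F (\row_j G j y) * partial i (G j) y)) => //.
- by move=> y /(dc ord0)[].
- by move=> i y /(dc i)[].
- move=> i; apply: Ck_sum => // j; apply: CkM => //; last exact: (CG j).2.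
  by apply: IH => //; [move=> k; exact/CkW/CG|exact: CF.2].
Qed.

Lemma Ck_coord n O j : open O -> Ck n O (fun y => y ord0 j).
Proof.
move=> oO; case: n => [|n].
  by split=> // y _; exact: differentiable_coord.
apply: (@CkS n O _ (fun i _ => (i == j)%:R)) => //.
- by move=> y _; exact: differentiable_coord.
- by move=> i y _; exact: partial_coord.
- by move=> i; exact: Ck_cst.
Qed.

(** Two smooth functions that agree on the half-space have the same first
    derivatives at its points: difference quotients can be taken with positive
    increments, along which every coordinate direction stays inside. *)
Lemma halfspace_partial_eq O F G i y : open O -> O y -> halfspace y ->
  (forall z, O z -> halfspace z -> F z = G z) ->
  differentiable F y -> differentiable G y -> partial i F y = partial i G y.
Proof.
move=> oO Oy Hy FG dF dG.
pose e : 'rV[R]_3 := delta_mx ord0 i.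
have cvgq H : differentiable H y ->
    h^-1 *: (H (h *: e + y) - H y) @[h --> 0^'+] --> partial i H y.
  move=> dH; have cvgH : h^-1 *: (H (h *: e + y) - H y) @[h --> 0^'] --> partial i H y.
    exact: diff_derivable.
  move=> A /cvgH /nbhs_ballP [_ /posnumP[r] rA].
  by exists r%:num => //= h rh /gt_eqF/negbT/rA; exact.
have cF := cvgq F dF; have cG := cvgq G dG.
suff cF' : h^-1 *: (F (h *: e + y) - F y) @[h --> 0^'+] --> partial i G y.
  exact: cvg_unique cF cF'.
apply: cvg_trans cG; apply: near_eq_cvg; near=> h.
rewrite (FG y)//; congr (_ *: (_ - _)); apply/esym/FG.
  near: h; apply: (@cvg_at_right_filter _ _ (fun h => h *: e + y) 0 y); last first.
    exact: open_nbhs_nbhs.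
  have : h *: e + y @[h --> (0 : R)] --> 0 *: e + y.
    by apply: cvgD; [apply: cvgZr_tmp; exact: cvg_id|exact: cvg_cst].
  by rewrite scale0r add0r.
rewrite /halfspace /= !mxE addr_ge0// mulr_ge0//.

Unshelve. all: by end_near. Qed.

Lemma is_derive_line F (e a : 'rV[R]_3) (t : R) : differentiable F (t *: e + a) ->
  is_derive t 1 (fun t => F (t *: e + a)) ('D_e F (t *: e + a)).
Proof.
move=> dF.
have E : (fun h : R => h^-1 *: (((fun t => F (t *: e + a)) \o shift t) (h *: 1) -
    F (t *: e + a))) =
    (fun h => h^-1 *: ((F \o shift (t *: e + a)) (h *: e) - F (t *: e + a))).
  apply/funext => h /=; congr (_ *: (F _ - _)).
  by rewrite [h *: 1]mulr1 scalerDl addrA.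
by apply: DeriveDef; rewrite /derivable /derive E//; exact: diff_derivable.
Qed.

(** The mean value theorem along [i] and then along [j] expresses the second
    difference over a small square by a mixed derivative; as the second difference
    is symmetric in [i] and [j], so are the mixed derivatives. *)
Lemma second_difference O F i j y (s : R) :
  let ei : 'rV[R]_3 := delta_mx ord0 i in let ej : 'rV[R]_3 := delta_mx ord0 j in
  smooth3 O F -> 0 < s ->
  (forall z, `|z - y| <= s * (`|ei| + `|ej|) -> O z) ->
  exists2 z, `|z - y| <= s * (`|ei| + `|ej|) &
    F (s *: ei + (s *: ej + y)) - F (s *: ei + y) - F (s *: ej + y) + F y
      = s * s * partial j (partial i F) z.
Proof.
move=> ei ej sF s0 HO.
have near_y t t' : 0 <= t <= s -> 0 <= t' <= s ->
    `|t *: ei + (t' *: ej + y) - y| <= s * (`|ei| + `|ej|).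
  move=> /andP[t0 ts] /andP[t0' ts']; rewrite addrA addrK.
  rewrite (le_trans (ler_normD _ _))// !normrZ !ger0_norm// mulrDr.
  by apply: lerD; rewrite ler_wpM2r.
have s_in : 0 <= s <= s by rewrite lexx ltW.
have z_in : 0 <= (0 : R) <= s by rewrite lexx ltW.
have oc t : t \in `]0, s[ -> 0 <= t <= s.
  by rewrite in_itv /= => /andP[/ltW -> /ltW ->].
have dF z : O z -> differentiable F z by exact: (sF [::]).
have dpF z : O z -> differentiable (partial i F) z by exact: (sF [:: i]).
have near_y0 t : 0 <= t <= s -> `|t *: ei + y - y| <= s * (`|ei| + `|ej|).
  by move=> /near_y/(_ z_in); rewrite scale0r add0r.
have D1 t : 0 <= t <= s -> is_derive t 1
    (fun t => F (t *: ei + (s *: ej + y)) - F (t *: ei + y))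
    (partial i F (t *: ei + (s *: ej + y)) - partial i F (t *: ei + y)).
  move=> ts; have dA := is_derive_line (dF _ (HO _ (near_y _ _ ts s_in))).
  have dB := is_derive_line (dF _ (HO _ (near_y0 _ ts))).
  by have := @is_deriveB _ _ _ _ _ _ _ _ _ dA dB.
have D1o t : t \in `]0, s[ -> _ := fun ts => D1 t (oc t ts).
have [|c cs] := MVT_segment (ltW s0) D1o.
  apply: derivable_within_continuous => t; rewrite in_itv /= => ts.
  by have [] := D1 t ts.
rewrite !scale0r !add0r subr0.
move: cs; rewrite in_itv /= => cs.
have D2 t : 0 <= t <= s -> is_derive t 1
    (fun t => partial i F (t *: ej + (c *: ei + y)))
    (partial j (partial i F) (t *: ej + (c *: ei + y))).
  move=> ts; apply/is_derive_line/dpF/HO.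
  by rewrite addrCA; exact: near_y.
have D2o t : t \in `]0, s[ -> _ := fun ts => D2 t (oc t ts).
have [|d ds] := MVT_segment (ltW s0) D2o.
  apply: derivable_within_continuous => t; rewrite in_itv /= => ts.
  by have [] := D2 t ts.
rewrite scale0r add0r subr0 => E2 E1.
move: ds; rewrite in_itv /= => ds.
exists (d *: ej + (c *: ei + y)).
  by rewrite addrCA; exact: near_y.
rewrite (addrCA (c *: ei)) {}E2 in E1.
move: (F _) (F _) (F _) (F y) (partial j _ _) E1 => A B C D P E1.
by rewrite (mulrC _ P) mulrA -E1 opprB (addrC D) addrA.
Qed.

Lemma schwarz O F i j y : open O -> smooth3 O F -> O y ->
  partial j (partial i F) y = partial i (partial j F) y.
Proof.
move=> oO sF Oy.
pose ei : 'rV[R]_3 := delta_mx ord0 i; pose ej : 'rV[R]_3 := delta_mx ord0 j.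
pose K := `|ei| + `|ej| + 1.
have K0 : 0 < K by rewrite ltr_wpDl ?addr_ge0.
have cont k l : {for y, continuous (partial k (partial l F))}.
  exact: differentiable_continuous (sF [:: k; l] y Oy).
apply/eqP; rewrite -subr_eq0 -normr_le0; apply/ler_addgt0Pr => e e0.
rewrite add0r.
have e20 : 0 < e / 2 by rewrite divr_gt0.
have Pnear : \forall z \near y, [/\ O z,
  `|partial j (partial i F) y - partial j (partial i F) z| < e / 2 &
  `|partial i (partial j F) y - partial i (partial j F) z| < e / 2].
  have /cvgrPdist_lt/(_ _ e20) C1 := cont j i.
  have /cvgrPdist_lt/(_ _ e20) C2 := cont i j.
  have CO : nbhs y O by exact: open_nbhs_nbhs.
  apply: filterS3 CO C1 C2 => z Oz C1z C2z.
  split; [exact: Oz|exact: C1z|exact: C2z].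
have /nbhs_ballP[r /= r0 rP] := Pnear.
pose s := r / (2 * K).
have s0 : 0 < s by rewrite divr_gt0// mulr_gt0.
have inr z : `|z - y| <= s * (`|ei| + `|ej|) -> ball y r z.
  move=> zs; rewrite -ball_normE /ball_ /= distrC (le_lt_trans zs)//.
  rewrite (@le_lt_trans _ _ (s * K))// ?ler_wpM2l ?(ltW s0) ?lerDl//.
  by rewrite /s invfM mulrA divfK ?gt_eqF// ltr_pdivrMr// ltr_pMr// ltr1n.
clearbody s.
have HO z : `|z - y| <= s * (`|ei| + `|ej|) -> O z by move=> /inr/rP[].
have [z1 /inr/rP[_ z1e _] E1] := @second_difference O F i j y s sF s0 HO.
have HO' z : `|z - y| <= s * (`|ej| + `|ei|) -> O z by rewrite (addrC `|ej|); exact: HO.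
have [z2 z2e E2] := @second_difference O F j i y s sF s0 HO'.
move: z2e; rewrite (addrC `|ej|) => /inr/rP[_ _ z2e].
have E : partial j (partial i F) z1 = partial i (partial j F) z2.
  apply: (mulfI (_ : s * s != 0)); first by rewrite mulf_neq0 ?gt_eqF.
  apply: etrans (esym E1) _; apply: etrans _ E2.
  by rewrite (addrCA (s *: _)) (addrAC (F _)).
rewrite (_ : _ - _ = (partial j (partial i F) y - partial j (partial i F) z1) -
  (partial i (partial j F) y - partial i (partial j F) z2)); last first.
  by rewrite E opprB addrA subrK.
apply: (le_trans (ler_normB _ _)); rewrite (splitr e).
exact: lerD (ltW z1e) (ltW z2e).
Qed.

Lemma smooth3_cst O (a : R) : open O -> smooth3 O (fun=> a).
Proof. by move=> oO; apply/smooth3P => n; exact: Ck_cst. Qed.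

Lemma smooth3_coord O j : open O -> smooth3 O (fun y => y ord0 j).
Proof. by move=> oO; apply/smooth3P => n; exact: Ck_coord. Qed.

Lemma smooth3D O F G : open O -> smooth3 O F -> smooth3 O G ->
  smooth3 O (fun y => F y + G y).
Proof.
by move=> oO /smooth3P CF /smooth3P CG; apply/smooth3P => n; exact: CkD.
Qed.

Lemma smooth3M O F G : open O -> smooth3 O F -> smooth3 O G ->
  smooth3 O (fun y => F y * G y).
Proof.
by move=> oO /smooth3P CF /smooth3P CG; apply/smooth3P => n; exact: CkM.
Qed.

Lemma smooth3V O F : open O -> (forall y, O y -> F y != 0) -> smooth3 O F ->
  smooth3 O (fun y => (F y)^-1).
Proof. by move=> oO F0 /smooth3P CF; apply/smooth3P => n; exact: CkV. Qed.

Lemma smooth3_ln O F : open O -> (forall y, O y -> 0 < F y) -> smooth3 O F ->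
  smooth3 O (fun y => ln (F y)).
Proof. by move=> oO F0 /smooth3P CF; apply/smooth3P => n; exact: Ck_ln. Qed.

Lemma smooth3_sub O O' F : O' `<=` O -> smooth3 O F -> smooth3 O' F.
Proof. by move=> sO sF s y /sO; exact: sF. Qed.

Lemma smooth3_partial O F i : smooth3 O F -> smooth3 O (partial i F).
Proof. by move=> sF s y Oy; rewrite -foldr_rcons; exact: sF. Qed.

Lemma smooth3_comp O O' F (G : 'I_3 -> 'rV[R]_3 -> R) : open O' ->
  (forall j, smooth3 O' (G j)) -> (forall y, O' y -> O (\row_j G j y)) ->
  smooth3 O F -> smooth3 O' (fun y => F (\row_j G j y)).
Proof.
move=> oO' CG OG /smooth3P CF; apply/smooth3P => n; apply: (Ck_comp oO' _ OG (CF n)) => j.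
by move/smooth3P: (CG j); exact.
Qed.

End Smooth3.

(** * Calculus on a manifold with boundary *)

Section Calculus.
Variables (R : realType) (M : bmanifold3 R).
Implicit Types (f g : M -> R) (p q : M) (c : chart R M) (U : set M).
Implicit Types (X Y Z : op M).

Lemma chart_continuous c p : cdom c p -> {for p, continuous c}.
Proof.
move=> cp; have := @cmap_continuous _ _ c.
rewrite continuous_open_subspace; last exact: cdom_open.
by apply; rewrite inE.
Qed.

Lemma near_chart c p (O : set 'rV[R]_3) : cdom c p -> open O -> O (c p) ->
  \forall q \near p, O (c q).
Proof. by move=> cp oO Op; apply: (chart_continuous cp); exact: open_nbhs_nbhs. Qed.

Lemma near_cdom c p : cdom c p -> \forall q \near p, cdom c q.
Proof. by move=> cp; apply: open_nbhs_nbhs; split=> //; exact: cdom_open. Qed.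

Lemma near_extends c f p O F : cdom c p -> extends_in c f p O F ->
  \forall q \near p, extends_in c f q O F.
Proof.
move=> cp [oO Op sF fF]; have := near_chart cp oO Op.
move/near_join : fF; apply: filterS2 => q; by split.
Qed.

Lemma extendsD c f g p O O' F G :
  extends_in c f p O F -> extends_in c g p O' G ->
  extends_in c (fun q => f q + g q) p (O `&` O') (fun y => F y + G y).
Proof.
move=> [oO Op sF fF] [oO' Op' sG gG]; split=> //; first exact: openI.
- apply: smooth3D; first exact: openI.
    by apply: smooth3_sub sF => y [].
  by apply: smooth3_sub sG => y [].
- by apply: filterS2 fF gG => q -> ->.
Qed.

Lemma extendsM c f g p O O' F G :
  extends_in c f p O F -> extends_in c g p O' G ->
  extends_in c (fun q => f q * g q) p (O `&` O') (fun y => F y * G y).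
Proof.
move=> [oO Op sF fF] [oO' Op' sG gG]; split=> //; first exact: openI.
- apply: smooth3M; first exact: openI.
    by apply: smooth3_sub sF => y [].
  by apply: smooth3_sub sG => y [].
- by apply: filterS2 fF gG => q -> ->.
Qed.

Lemma extends_cst c p (a : R) : extends_in c (fun=> a) p setT (fun=> a).
Proof.
by split=> //; [exact: openT|apply: smooth3_cst; exact: openT|near=> q].
Unshelve. all: by end_near. Qed.

Lemma extends_partial c f p O F i : extends_in c f p O F ->
  extends_in c (fun q => partial i F (c q)) p O (partial i F).
Proof.
by move=> [oO Op sF fF]; split=> //; [exact: smooth3_partial|near=> q].
Unshelve. all: by end_near. Qed.

Lemma extends_coord c p i :
  extends_in c (fun q => c q ord0 i) p setT (fun y => y ord0 i).
Proof.
by split=> //; [exact: openT|apply: smooth3_coord; exact: openT|near=> q].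
Unshelve. all: by end_near. Qed.

Lemma extends_near_eq c f g p O F : (\forall q \near p, f q = g q) ->
  extends_in c f p O F -> extends_in c g p O F.
Proof. by move=> fg [oO Op sF fF]; split=> //; apply: filterS2 fg fF => q ->. Qed.

(** An inverse or a logarithm of an extension is defined throughout its domain
    once that domain has been shrunk. *)
Lemma extends_restrict c f p O F (A : set R) : open A -> A (F (c p)) ->
  extends_in c f p O F -> exists2 O', extends_in c f p O' F &
    forall y, O' y -> A (F y).
Proof.
move=> oA Ap [oO Op sF fF]; exists (O `&` F @^-1` A); last by move=> y [].
split=> //.
- rewrite openE => y [ Oy Ay]; apply: filterI; first exact: open_nbhs_nbhs.
  apply: (differentiable_continuous (sF [::] y Oy)); exact: open_nbhs_nbhs.
- by apply: smooth3_sub sF => y [].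
Qed.

Lemma smooth_inV c f p : f p != 0 -> smooth_in c f p ->
  smooth_in c (fun q => (f q)^-1) p.
Proof.
move=> f0 [D [F eF]]; have [_ _ _ fF] := eF.
have [||O' [oO' O'p sF fF'] F0] := @extends_restrict c f p D F [set t | t != 0] _ _ eF.
- exact: open_neq.
- by rewrite /= -(nbhs_singleton fF).
exists O', (fun y => (F y)^-1); split=> //; first exact: smooth3V.
by apply: filterS fF' => q ->.
Qed.

Lemma smooth_in_ln c f p : 0 < f p -> smooth_in c f p ->
  smooth_in c (fun q => ln (f q)) p.
Proof.
move=> f0 [D [F eF]]; have [_ _ _ fF] := eF.
have [||O' [oO' O'p sF fF'] F0] := @extends_restrict c f p D F [set t | 0 < t] _ _ eF.
- exact: open_gt.
- by rewrite /= -(nbhs_singleton fF).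
exists O', (fun y => ln (F y)); split=> //; first exact: smooth3_ln.
by apply: filterS fF' => q ->.
Qed.

Lemma extends_comp c c' f p (Oj : 'I_3 -> set 'rV[R]_3)
    (G : 'I_3 -> 'rV[R]_3 -> R) O F :
  cdom c' p ->
  (forall j, extends_in c (fun q => c' q ord0 j) p (Oj j) (G j)) ->
  extends_in c' f p O F ->
  exists O', extends_in c f p O' (fun y => F (\row_j G j y)).
Proof.
move=> c'p eG [oO Op sF fF].
pose g y := \row_j G j y.
pose A := [set y | forall j, Oj j y].
have oA : open A.
  rewrite openE => y Ay.
  suff : \forall z \near y, forall j, Oj j z by [].
  apply: (@filter_forall _ 'I_3 Oj (nbhs y)) => j.
  by apply: open_nbhs_nbhs; split; [case: (eG j)|exact: Ay].
have gc q : (forall j, c' q ord0 j = G j (c q)) -> g (c q) = c' q.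
  by move=> E; apply/rowP => j; rewrite mxE -E.
have near_gc : \forall q \near p, g (c q) = c' q.
  have : \forall q \near p, forall j, c' q ord0 j = G j (c q).
    apply: (@filter_forall _ 'I_3 (fun j q => c' q ord0 j = G j (c q)) (nbhs p)) => j.
    by case: (eG j).
  by apply: filterS => q; exact: gc.
have cg y : A y -> {for y, continuous g}.
  move=> Ay; apply: differentiable_continuous.
  apply: differentiable_row => j; case: (eG j) => _ _ sG _.
  exact: (sG [::] y (Ay j)).

pose O' := A `&` g @^-1` O.
have oO' : open O'.
  rewrite openE => y [Ay Oy]; apply: filterI; first exact: open_nbhs_nbhs.
  by apply: (cg y Ay); exact: open_nbhs_nbhs.
exists O'; split=> //.
- split; first by move=> j; case: (eG j).
  by rewrite /preimage /= (nbhs_singleton near_gc).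
- apply: (@smooth3_comp _ O O' F G) => //; last by move=> y [].
  by move=> j; case: (eG j) => _ _ sG _; apply: smooth3_sub sG => y [/(_ j)].
- by apply: filterS2 fF near_gc => q -> <-.
Qed.

(** One chart is enough, because the transition maps are smooth. *)
Lemma smooth_at_chart c f p : atlas c -> cdom c p -> smooth_in c f p ->
  smooth_at f p.
Proof.
move=> ac cp [D [F eF]] c' ac' c'p.
have /choice[HG HGP] : forall j, exists OG : set 'rV[R]_3 * ('rV[R]_3 -> R),
    extends_in c' (fun q => c q ord0 j) p OG.1 OG.2.
  by move=> j; have [D' [G eG]] := atlas_compat ac' ac c'p cp j; exists (D', G).
have [N eN] := extends_comp cp HGP eF.
by exists N, (fun y => F (\row_j (HG j).2 y)).
Qed.

Lemma smooth_at_near f p : smooth_at f p -> \forall q \near p, smooth_at f q.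
Proof.
move=> sf; have [c ac cp] := atlas_cover p.
have [D [F eF]] := sf c ac cp.
have := near_extends cp eF; have := near_cdom cp.
apply: filterS2 => q cq eFq; apply: (smooth_at_chart ac cq).
by exists D, F.
Qed.

Lemma smooth_at_near_eq f g p : (\forall q \near p, f q = g q) ->
  smooth_at f p -> smooth_at g p.
Proof.
move=> fg sf c ac cp; have [D [F eF]] := sf c ac cp.
by exists D, F; exact: extends_near_eq eF.
Qed.

Lemma smooth_at_continuous f p : smooth_at f p -> {for p, continuous f}.
Proof.
move=> sf; have [c ac cp] := atlas_cover p.
have [D [F [oD Dp sF fF]]] := sf c ac cp.
have FC : {for p, continuous (F \o c)}.
  apply: continuous_comp; first exact: chart_continuous.
  exact: differentiable_continuous (sF [::] (c p) Dp).
have fp := nbhs_singleton fF.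
rewrite /prop_for /continuous_at fp; apply: cvg_trans FC.
by apply: near_eq_cvg; apply: filterS fF => q ->.
Qed.

Lemma smooth_at_cst (a : R) p : smooth_at (fun=> a) p.
Proof. by move=> c _ _; exists setT, (fun=> a); exact: extends_cst. Qed.

Lemma smooth_atD f g p : smooth_at f p -> smooth_at g p ->
  smooth_at (fun q => f q + g q) p.
Proof.
move=> sf sg c ac cp; have [D [F eF]] := sf c ac cp.
have [D' [G eG]] := sg c ac cp.
by exists (D `&` D'), (fun y => F y + G y); exact: extendsD.
Qed.

Lemma smooth_atM f g p : smooth_at f p -> smooth_at g p ->
  smooth_at (fun q => f q * g q) p.
Proof.
move=> sf sg c ac cp; have [D [F eF]] := sf c ac cp.
have [D' [G eG]] := sg c ac cp.
by exists (D `&` D'), (fun y => F y * G y); exact: extendsM.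
Qed.

Lemma smooth_atN f p : smooth_at f p -> smooth_at (fun q => - f q) p.
Proof.
move=> sf; have := smooth_atM (@smooth_at_cst (-1) p) sf.
by apply: smooth_at_near_eq; near=> q; rewrite mulN1r.
Unshelve. all: by end_near. Qed.

Lemma smooth_atB f g p : smooth_at f p -> smooth_at g p ->
  smooth_at (fun q => f q - g q) p.
Proof. by move=> sf sg; apply: smooth_atD => //; exact: smooth_atN. Qed.

Lemma smooth_atX f n p : smooth_at f p -> smooth_at (fun q => f q ^+ n) p.
Proof.
move=> sf; elim: n => [|n IH]; first exact: (@smooth_at_cst 1 p).
have := smooth_atM sf IH.
by apply: smooth_at_near_eq; near=> q; rewrite exprS.
Unshelve. all: by end_near. Qed.

Lemma smooth_atV f p : f p != 0 -> smooth_at f p ->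
  smooth_at (fun q => (f q)^-1) p.
Proof. by move=> f0 sf c ac cp; apply: smooth_inV => //; exact: sf. Qed.

Lemma smooth_at_ln f p : 0 < f p -> smooth_at f p ->
  smooth_at (fun q => ln (f q)) p.
Proof. by move=> f0 sf c ac cp; apply: smooth_in_ln => //; exact: sf. Qed.

Lemma smooth_at_sum (I : Type) (r : seq I) (F : I -> M -> R) p :
  (forall i, smooth_at (F i) p) -> smooth_at (fun q => \sum_(i <- r) F i q) p.
Proof.
move=> sF; elim: r => [|i r IH].
  by apply: smooth_at_near_eq (@smooth_at_cst 0 p); near=> q; rewrite big_nil.
by apply: smooth_at_near_eq (smooth_atD (sF i) IH); near=> q; rewrite big_cons.
Unshelve. all: by end_near. Qed.

(** * Vector fields as derivations *)

Lemma near_open U p : open U -> U p -> \forall q \near p, U q.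
Proof. by move=> oU Up; exact: open_nbhs_nbhs. Qed.

Section VectorField.
Variables (U : set M) (X : op M).
Hypotheses (oU : open U) (vX : vfield U X).

Lemma vfieldD f g p : U p -> smooth_at f p -> smooth_at g p ->
  X (fun q => f q + g q) p = X f p + X g p.
Proof.
move=> Up sf sg; have [c ac cp] := atlas_cover p.
have [b [sb Xb]] := vX ac.
have [D [F eF]] := sf c ac cp; have [D' [G eG]] := sg c ac cp.
rewrite (Xb _ _ _ _ Up cp (extendsD eF eG)) (Xb _ _ _ _ Up cp eF) (Xb _ _ _ _ Up cp eG).
rewrite -big_split /=; apply: eq_bigr => i _; rewrite -mulrDr partialD//.
  by case: eF => oD Dp sF _; exact: (sF [::]).
by case: eG => oD Dp sF _; exact: (sF [::]).
Qed.

Lemma vfieldM f g p : U p -> smooth_at f p -> smooth_at g p ->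
  X (fun q => f q * g q) p = X f p * g p + f p * X g p.
Proof.
move=> Up sf sg; have [c ac cp] := atlas_cover p.
have [b [sb Xb]] := vX ac.
have [D [F eF]] := sf c ac cp; have [D' [G eG]] := sg c ac cp.
rewrite (Xb _ _ _ _ Up cp (extendsM eF eG)) (Xb _ _ _ _ Up cp eF) (Xb _ _ _ _ Up cp eG).
rewrite mulr_suml mulr_sumr -big_split /=; apply: eq_bigr => i _.
case: eF => oD Dp sF fF; case: eG => oD' Dp' sG fG.
rewrite (nbhs_singleton fF) (nbhs_singleton fG) partialM; last 2 first.
- exact: (sF [::]).
- exact: (sG [::]).
by rewrite mulrDr mulrA; congr (_ + _); rewrite mulrCA.
Qed.

Lemma vfield_cst (a : R) p : U p -> X (fun=> a) p = 0.
Proof.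
move=> Up; have [c ac cp] := atlas_cover p; have [b [sb Xb]] := vX ac.
rewrite (Xb _ _ _ _ Up cp (extends_cst c p a)) big1// => i _.
by rewrite /partial derive_cst mulr0.
Qed.

Lemma vfield_near_eq f g p : U p -> smooth_at f p ->
  (\forall q \near p, f q = g q) -> X f p = X g p.
Proof.
move=> Up sf fg; have [c ac cp] := atlas_cover p.
have [b [sb Xb]] := vX ac; have [D [F eF]] := sf c ac cp.
by rewrite (Xb _ _ _ _ Up cp eF) (Xb _ _ _ _ Up cp (extends_near_eq fg eF)).
Qed.

Lemma vfieldN f p : U p -> smooth_at f p -> X (fun q => - f q) p = - X f p.
Proof.
move=> Up sf.
have E : X (fun q => f q + (- f q)) p = 0.
  rewrite -(vfield_cst 0 Up); apply: vfield_near_eq => //.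
    by apply: smooth_atD => //; exact: smooth_atN.
  by near=> q; rewrite subrr.
rewrite vfieldD// in E; last exact: smooth_atN.
by apply/eqP; rewrite -addr_eq0 addrC E.
Unshelve. all: by end_near. Qed.

Lemma vfieldB f g p : U p -> smooth_at f p -> smooth_at g p ->
  X (fun q => f q - g q) p = X f p - X g p.
Proof. by move=> Up sf sg; rewrite vfieldD// ?vfieldN//; exact: smooth_atN. Qed.

Lemma vfieldX f n p : U p -> smooth_at f p ->
  X (fun q => f q ^+ n) p = n%:R * f p ^+ n.-1 * X f p.
Proof.
move=> Up sf; elim: n => [|n IH]; first by rewrite !mul0r; exact: vfield_cst.
rewrite -(@vfield_near_eq (fun q => f q * f q ^+ n))//; last 2 first.
- by apply: smooth_atM => //; exact: smooth_atX.
- by near=> q; rewrite exprS.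
rewrite vfieldM// ?IH; last exact: smooth_atX.
case: n {IH} => [|n]; first by rewrite !mul0r mulr0 addr0 expr0 !mulr1 mul1r.
by rewrite /= exprS -[n.+2%:R]natr1; ring.
Unshelve. all: by end_near. Qed.

Lemma vfield_ln f p : U p -> smooth_at f p -> 0 < f p ->
  X (fun q => ln (f q)) p = X f p / f p.
Proof.
move=> Up sf f0; have [c ac cp] := atlas_cover p; have [b [sb Xb]] := vX ac.
have [D [F eF]] := sf c ac cp; have [_ _ _ fF] := eF.
have [||O' eF' F0] := @extends_restrict c f p D F [set t | 0 < t] _ _ eF.
- exact: open_gt.
- by rewrite /= -(nbhs_singleton fF).
have eln : extends_in c (fun q => ln (f q)) p O' (fun y => ln (F y)).
  case: eF' => oO' O'p sF fF'; split=> //; first exact: smooth3_ln.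
  by apply: filterS fF' => q ->.
rewrite (Xb _ _ _ _ Up cp eF) (Xb _ _ _ _ Up cp eln) mulr_suml.
apply: eq_bigr => i _; case: eF' => oO' O'p sF fF'.
have [_ ->] := partial_ln i (sF [::] _ O'p) (F0 _ O'p).
by rewrite mulrA (nbhs_singleton fF).
Qed.

Lemma vfield_smooth f p : U p -> smooth_at f p -> smooth_at (X f) p.
Proof.
move=> Up sf; have [c ac cp] := atlas_cover p; have [b [sb Xb]] := vX ac.
have [D [F eF]] := sf c ac cp.
apply: (@smooth_at_near_eq (fun q => \sum_(i < 3) b i q * partial i F (c q))).
  have := near_extends cp eF; have := near_cdom cp; have := near_open oU Up.
  by apply: filterS3 => q Uq cq eFq; rewrite (Xb _ _ _ _ Uq cq eFq).
apply: smooth_at_sum => i; apply: smooth_atM; first by apply: sb.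
by apply: (smooth_at_chart ac cp); exists D, (partial i F); exact: extends_partial eF.
Qed.

Lemma vfield_sum (I : Type) (r : seq I) (F : I -> M -> R) p : U p ->
  (forall i, smooth_at (F i) p) ->
  X (fun q => \sum_(i <- r) F i q) p = \sum_(i <- r) X (F i) p.
Proof.
move=> Up sF; elim: r => [|i r IH].
  rewrite big_nil; transitivity (X (fun=> 0) p); last exact: vfield_cst.
  apply/esym/(vfield_near_eq Up (smooth_at_cst 0 (p := p))).
  by near=> q; rewrite big_nil.
have E : \forall q \near p, F i q + \sum_(i <- r) F i q = \sum_(i <- i :: r) F i q.
  by near=> q; rewrite big_cons.
have sr := smooth_at_sum r sF.
rewrite -(vfield_near_eq Up (smooth_atD (sF i) sr) E) vfieldD// IH.
by rewrite big_cons.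
Unshelve. all: by end_near. Qed.

End VectorField.
End Calculus.

(** * Lie brackets and coordinate fields *)

Section Brackets.
Variables (R : realType) (M : bmanifold3 R).
Implicit Types (f g : M -> R) (p q : M) (c : chart R M) (U : set M).
Implicit Types (X Y Z : op M).

Lemma vfieldS U U' X : U' `<=` U -> vfield U X -> vfield U' X.
Proof.
move=> sU vX c ac; have [b [sb Xb]] := vX c ac; exists b; split.
  by move=> i p [/sU Up cp]; apply: sb.
by move=> f p D F /sU; exact: Xb.
Qed.

Lemma vfield_veq U X Y : veq U X Y -> vfield U X -> vfield U Y.
Proof.
move=> XY vX c ac; have [b [sb Xb]] := vX c ac; exists b; split=> //.
move=> f p D F Up cp eF; rewrite -(Xb f p D F Up cp eF) XY//.
by apply: (smooth_at_chart ac cp); exists D, F.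
Qed.

Lemma vfield_vadd U X Y : vfield U X -> vfield U Y -> vfield U (vadd X Y).
Proof.
move=> vX vY c ac; have [b [sb Xb]] := vX c ac; have [d [sd Yd]] := vY c ac.
exists (fun i p => b i p + d i p); split.
  by move=> i p Up; apply: smooth_atD; [exact: sb|exact: sd].
move=> f p D F Up cp eF; rewrite /vadd (Xb f p D F Up cp eF) (Yd f p D F Up cp eF).
by rewrite -big_split /=; apply: eq_bigr => i _; rewrite mulrDl.
Qed.

Lemma vfield_vscale U (a : M -> R) X : smooth_on U a -> vfield U X ->
  vfield U (vscale a X).
Proof.
move=> sa vX c ac; have [b [sb Xb]] := vX c ac.
exists (fun i p => a p * b i p); split.
  by move=> i p Up; apply: smooth_atM; [exact: sa Up.1|exact: sb].
move=> f p D F Up cp eF; rewrite /vscale (Xb f p D F Up cp eF) mulr_sumr.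
by apply: eq_bigr => i _; rewrite mulrA.
Qed.

Lemma vfield_vopp U X : vfield U X -> vfield U (vopp X).
Proof.
move=> vX; apply: (@vfield_veq U (vscale (fun=> -1) X)).
  by move=> p Up f sf; rewrite /vscale mulN1r.
by apply: vfield_vscale => // p Up; exact: smooth_at_cst.
Qed.

Lemma vfield_vzero U : vfield U (@vzero R M).
Proof.
move=> c ac; exists (fun _ _ => 0); split=> [i p Up|f p D F Up cp eF].
  exact: smooth_at_cst.
by rewrite big1// => i _; rewrite mul0r.
Qed.

(** Second derivatives drop out of the commutator by symmetry, which is what
    makes it a first-order operator. *)
Lemma vfield_bracket U X Y : open U -> vfield U X -> vfield U Y ->
  vfield U (bracket X Y).
Proof.
move=> oU vX vY c ac; have [b [sb Xb]] := vX c ac; have [d [sd Yd]] := vY c ac.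
exists (fun i p => X (d i) p - Y (b i) p); split.
  move=> i p [Up cp].
  by apply: smooth_atB; [apply: (vfield_smooth oU vX Up); apply: sd|
    apply: (vfield_smooth oU vY Up); apply: sb].
have half X' Y' (b' d' : 'I_3 -> M -> R) : vfield U X' ->
    (forall i, smooth_on (U `&` cdom c) (d' i)) ->
    (forall (f : M -> R) (p : M) O F, U p -> cdom c p -> extends_in c f p O F ->
       X' f p = \sum_(i < 3) b' i p * partial i F (c p)) ->
    (forall (f : M -> R) (p : M) O F, U p -> cdom c p -> extends_in c f p O F ->
       Y' f p = \sum_(i < 3) d' i p * partial i F (c p)) ->
    forall f p D F, U p -> cdom c p -> extends_in c f p D F ->
    X' (Y' f) p = \sum_(i < 3) X' (d' i) p * partial i F (c p) +
      \sum_(i < 3) \sum_(j < 3) d' i p * b' j p * partial j (partial i F) (c p).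
  move=> vX' sd' Xb' Yd' f p D F Up cp eF.
  have sP i : smooth_at (fun q => partial i F (c q)) p.
    by apply: (smooth_at_chart ac cp); exists D, (partial i F); exact: extends_partial eF.
  have sdi i : smooth_at (d' i) p by apply: sd'.
  rewrite -(@vfield_near_eq _ _ _ X' vX' (fun q => \sum_(i < 3) d' i q * partial i F (c q)))//.
  - rewrite (vfield_sum vX')// -?big_split /=; last by move=> i; exact: smooth_atM.
    apply: eq_bigr => i _; rewrite (vfieldM vX')//; congr (_ + _).
    rewrite (Xb' _ _ _ _ Up cp (extends_partial i eF)) mulr_sumr.
    by apply: eq_bigr => j _; rewrite mulrA.
  - by apply: smooth_at_sum => i; exact: smooth_atM.
  - have := near_extends cp eF; have := near_cdom cp; have := near_open oU Up.
    by apply: filterS3 => q Uq cq eFq; rewrite (Yd' _ _ _ _ Uq cq eFq).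
move=> f p D F Up cp eF; rewrite /bracket.
rewrite (half X Y b d vX sd Xb Yd f p D F Up cp eF).
rewrite (half Y X d b vY sb Yd Xb f p D F Up cp eF).
have -> : \sum_(i < 3) \sum_(j < 3) d i p * b j p * partial j (partial i F) (c p)
    = \sum_(i < 3) \sum_(j < 3) b i p * d j p * partial j (partial i F) (c p).
  rewrite exchange_big; apply: eq_bigr => i _; apply: eq_bigr => j _.
  case: eF => oD Dp sF _; rewrite (schwarz i j oD sF Dp).
  by congr (_ * _); exact: mulrC.
rewrite opprD addrACA subrr addr0 -sumrB; apply: eq_bigr => i _.
by rewrite mulrBl.
Qed.

Lemma bracket_veq U X X' Y Y' : open U -> vfield U X -> vfield U X' ->
  vfield U Y -> vfield U Y' -> veq U X X' -> veq U Y Y' ->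
  veq U (bracket X Y) (bracket X' Y').
Proof.
move=> oU vX vX' vY vY' XX YY p Up f sf; rewrite /bracket.
have sn : \forall q \near p, U q /\ smooth_at f q.
  by apply: filterS2 (near_open oU Up) (smooth_at_near sf).
have XXn : \forall q \near p, X f q = X' f q by apply: filterS sn => q [Uq]; exact: XX.
have YYn : \forall q \near p, Y f q = Y' f q by apply: filterS sn => q [Uq]; exact: YY.
rewrite -(vfield_near_eq vX' Up (vfield_smooth oU vY Up sf) YYn).
rewrite -(vfield_near_eq vY' Up (vfield_smooth oU vX Up sf) XXn).
by rewrite XX ?YY//; exact: vfield_smooth Up sf.
Qed.

(** The coordinate field [d/dy_i] of the chart [c]. A choice of extension is
    needed, as a field acts on functions on the manifold; two extensions agree on
    the half-space and hence have the same derivatives there. *)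
Definition coord_field c (i : 'I_3) : op M := fun f p =>
  partial i (xget (fun=> 0) [set F | exists D, extends_in c f p D F]) (c p).

Lemma coord_fieldE c i f p D F : cdom c p -> extends_in c f p D F ->
  coord_field c i f p = partial i F (c p).
Proof.
move=> cp eF; rewrite /coord_field.
case: xgetP => [G _ [D' eG]|/(_ F)[]]; last by exists D.
case: eG => oD' Dp' sG fG; case: eF => oD Dp sF fF.
have : nbhs p [set q | cdom c q /\ F (c q) = G (c q)].
  by apply: filterS3 (near_cdom cp) fF fG => q cq E1 E2; rewrite /= -E1 -E2.
rewrite nbhsE => -[A [oA Ap] AFG].
have [|V oV AV] := @cmap_open _ _ c A oA; first by move=> q /AFG[].
have /(_ (c p)) : (c @` A) `<=` V `&` @halfspace R by rewrite AV.
case; first by exists p.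
move=> Vp hp.
apply: (halfspace_partial_eq i oV Vp hp _ (sG [::] _ Dp') (sF [::] _ Dp)).
move=> z Vz hz; have : (V `&` @halfspace R) z by [].
by rewrite -AV => -[q /AFG[_ E] <-]; exact/esym.
Qed.

Lemma coord_field_vfield c i : atlas c -> vfield (cdom c) (coord_field c i).
Proof.
move=> ac c' ac'.
exists (fun j => coord_field c i (fun q => c' q ord0 j)); split.
  move=> j p [cp c'p]; have [D [F eF]] := atlas_compat ac ac' cp c'p j.
  apply: (@smooth_at_near_eq _ _ (fun q => partial i F (c q))).
    have := near_extends cp eF; have := near_cdom cp.
    by apply: filterS2 => q cq eFq; rewrite (coord_fieldE _ cq eFq).
  by apply: (smooth_at_chart ac cp); exists D, (partial i F); exact: extends_partial eF.
move=> f p D F cp c'p eF.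
have /choice[HG HGP] : forall j, exists DG : set 'rV[R]_3 * ('rV[R]_3 -> R),
    extends_in c (fun q => c' q ord0 j) p DG.1 DG.2.
  by move=> j; have [D' [G eG]] := atlas_compat ac ac' cp c'p j; exists (D', G).
have [N eN] := extends_comp c'p HGP eF.
have gc : \row_j (HG j).2 (c p) = c' p.
  by apply/rowP => j; rewrite mxE; case: (HGP j) => _ _ _ /nbhs_singleton.
rewrite (coord_fieldE _ cp eN).
have [||_ ->] := @partial_comp _ F (fun j => (HG j).2) i (c p).
- by move=> j; case: (HGP j) => _ DGp sG _; exact: (sG [::]).
- by rewrite gc; case: eF => _ Dp sF _; exact: (sF [::]).
apply: eq_bigr => j _; rewrite (coord_fieldE _ cp (HGP j)) gc mulrC.
by [].
Qed.

Lemma vfield_coordE U X c f p : vfield U X -> atlas c -> U p -> cdom c p ->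
  smooth_at f p ->
  X f p = \sum_(i < 3) X (fun q => c q ord0 i) p * coord_field c i f p.
Proof.
move=> vX ac Up cp sf; have [b [sb Xb]] := vX c ac.
have [D [F eF]] := sf c ac cp.
rewrite (Xb _ _ _ _ Up cp eF); apply: eq_bigr => i _.
rewrite (coord_fieldE _ cp eF); congr (_ * _).
rewrite (Xb _ _ _ _ Up cp (extends_coord c p i)) (bigD1 i)//=.
rewrite partial_coord eqxx mulr1 big1 ?addr0// => j /negbTE ji.
by rewrite partial_coord ji mulr0.
Qed.

End Brackets.

Section Forms.
Variables (R : realType) (M : bmanifold3 R) (U : set M) (eta : op M -> M -> R).
Hypothesis eta_form : is_form U eta.
Implicit Types (f g : M -> R) (p q : M) (D : set M) (X Y Z : op M).

Lemma form_add D X Y p : open D -> D `<=` U -> vfield D X -> vfield D Y -> D p ->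
  eta (vadd X Y) p = eta X p + eta Y p.
Proof.
move=> oD sD vX vY Dp.
have s1 : smooth_on D (fun=> 1 : R) by move=> q _; exact: smooth_at_cst.
have := form_linear eta_form oD sD vX vY s1 Dp; rewrite mul1r => <-.
have v1 : vfield D (vadd (vscale (fun=> 1) X) Y).
  by apply: vfield_vadd => //; exact: vfield_vscale.
apply: (form_congr eta_form oD sD _ v1) => //; first exact: vfield_vadd.
by move=> q Dq f sf; rewrite /vadd /vscale mul1r.
Qed.

Lemma form_vzero D p : open D -> D `<=` U -> D p -> eta (@vzero R M) p = 0.
Proof.
move=> oD sD Dp; have v0 := @vfield_vzero R M D.
have E : eta (vadd (@vzero R M) (@vzero R M)) p = eta (@vzero R M) p.
  apply: (form_congr eta_form oD sD) => //; first exact: vfield_vadd.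
  by move=> q Dq f sf; rewrite /vadd /vzero addr0.
by apply: (addrI (eta (@vzero R M) p)); rewrite -(form_add oD sD v0 v0 Dp) E addr0.
Qed.

Lemma form_scale D X a p : open D -> D `<=` U -> vfield D X -> smooth_on D a ->
  D p -> eta (vscale a X) p = a p * eta X p.
Proof.
move=> oD sD vX sa Dp; have v0 := @vfield_vzero R M D.
have := form_linear eta_form oD sD vX v0 sa Dp.
rewrite (form_vzero oD sD Dp) addr0 => <-.
have vs := vfield_vscale sa vX.
apply: (form_congr eta_form oD sD vs (vfield_vadd vs v0)) => //.
by move=> q Dq f sf; rewrite /vadd /vzero addr0.
Qed.

End Forms.

Section FormBracket.
Variables (R : realType) (M : bmanifold3 R).
Implicit Types (p q : M) (U : set M) (X Y Z : op M).

Definition combination (a : 'I_3 -> M -> R) (E : 'I_3 -> op M) (r : seq 'I_3) :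
  op M := fun f p => \sum_(i <- r) a i p * E i f p.

Lemma combination_cons U a E i r :
  veq U (combination a E (i :: r)) (vadd (vscale (a i) (E i)) (combination a E r)).
Proof. by move=> p Up f sf; rewrite /combination big_cons. Qed.

Lemma combination_nil U a E : veq U (combination a E [::]) (@vzero R M).
Proof. by move=> p Up f sf; rewrite /combination big_nil. Qed.

Lemma veq_sym U X Y : veq U X Y -> veq U Y X.
Proof. by move=> XY p Up f sf; rewrite XY. Qed.

Lemma vfield_combination U a E r : (forall i, smooth_on U (a i)) ->
  (forall i, vfield U (E i)) -> vfield U (combination a E r).
Proof.
move=> sa vE; elim: r => [|i r IH].
  exact: vfield_veq (veq_sym (@combination_nil U a E)) (vfield_vzero U).
apply: vfield_veq (veq_sym (@combination_cons U a E i r)) _.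
by apply: vfield_vadd => //; exact: vfield_vscale.
Qed.

Lemma form_combination U U' eta a E r p : is_form U' eta -> open U -> U `<=` U' ->
  (forall i, smooth_on U (a i)) -> (forall i, vfield U (E i)) -> U p ->
  eta (combination a E r) p = \sum_(i <- r) a i p * eta (E i) p.
Proof.
move=> eta_form oU sU sa vE Up.
have vC s : vfield U (combination a E s) by exact: vfield_combination.
elim: r => [|i r IH].
  rewrite big_nil -(form_vzero eta_form oU sU Up).
  apply: (form_congr eta_form oU sU (vC _) (vfield_vzero U)) => //.
  exact: combination_nil.
have vs := vfield_vscale (sa i) (vE i).
rewrite big_cons -IH -(form_scale eta_form oU sU (vE i) (sa i) Up).
rewrite -(form_add eta_form oU sU vs (vC r) Up).
apply: (form_congr eta_form oU sU (vC _) (vfield_vadd vs (vC r))) => //.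
exact: combination_cons.
Qed.

Lemma vfield_eq0 U X f p : open U -> vfield U X -> U p ->
  (forall q, U q -> f q = 0) -> X f p = 0.
Proof.
move=> oU vX Up f0; transitivity (X (fun=> 0) p); last exact: (vfield_cst vX 0 Up).
apply/esym/(vfield_near_eq vX Up (smooth_at_cst 0 (p := p))).
by apply: filterS (near_open oU Up) => q Uq; exact: esym (f0 q Uq).
Qed.

(** Pointwise nature of [d eta]: if [eta Y] vanishes identically then
    [eta [Y, Z] = - d eta(Y, Z) + Y (eta Z)] only depends on the value of [Y] at
    the point. In coordinates [Y = sum_i b_i d_i], and
    [[Y, Z] = sum_i b_i [d_i, Z] - Z(b_i) d_i], where the last sum is killed by
    differentiating [sum_i b_i eta(d_i) = 0] along [Z]. *)
Lemma form_bracket_eq0 U U' eta Y Z p : is_form U' eta -> open U -> U `<=` U' ->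
  vfield U Y -> vfield U Z -> (forall q, U q -> eta Y q = 0) -> U p ->
  (forall k, smooth_at k p -> Y k p = 0) -> eta (bracket Y Z) p = 0.
Proof.
move=> eta_form oU sU vY vZ etaY Up Y0.
have [c ac cp] := atlas_cover p.
pose D := U `&` cdom c; pose b i : M -> R := Y (fun q => c q ord0 i).
pose E i := coord_field c i; pose r := index_enum ('I_3 : finType).
have oD : open D by apply: openI => //; exact: cdom_open.
have Dp : D p by [].
have sD : D `<=` U' by move=> q [/sU].
have vYD : vfield D Y by apply: vfieldS vY => q [].
have vZD : vfield D Z by apply: vfieldS vZ => q [].
have sc i q : D q -> smooth_at (fun q => c q ord0 i) q.
  move=> [_ cq]; apply: (smooth_at_chart ac cq).
  by exists setT, (fun y => y ord0 i); exact: extends_coord.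
have sb i : smooth_on D (b i) by move=> q Dq; exact: (vfield_smooth oD vYD Dq (sc i q Dq)).
have vE i : vfield D (E i) by apply: vfieldS (coord_field_vfield i ac) => q [].
have sZb i : smooth_on D (fun q => - Z (b i) q).
  by move=> q Dq; apply/smooth_atN/(vfield_smooth oD vZD Dq)/sb.
have vEZ i : vfield D (bracket (E i) Z) by exact: vfield_bracket.
have YE q k : D q -> smooth_at k q -> Y k q = combination b E r k q.
  by move=> [Uq cq] sk; rewrite (vfield_coordE vY ac Uq cq sk).
have YEv : veq D Y (combination b E r) by move=> q Dq k sk; exact: YE.
have etaE q : D q -> \sum_(i <- r) b i q * eta (E i) q = 0.
  move=> Dq; rewrite -(form_combination r eta_form oD sD sb vE Dq) -(etaY q Dq.1).
  apply/esym; apply: (form_congr eta_form oD sD vYD _ YEv Dq).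
  exact: vfield_combination.
have seta i : smooth_on D (eta (E i)) by exact: (form_smooth eta_form oD sD).
have b0 i : b i p = 0 by exact: Y0 (sc i p Dp).
have Zeta : \sum_(i <- r) Z (b i) p * eta (E i) p = 0.
  have : Z (fun q => \sum_(i <- r) b i q * eta (E i) q) p = 0.
    exact: (vfield_eq0 oD vZD Dp etaE).
  rewrite (vfield_sum vZD)//; last first.
    by move=> i; apply: smooth_atM; [exact: sb|exact: seta].
  under eq_bigr => i _.
    rewrite (vfieldM vZD Dp (sb i p Dp) (seta i p Dp)) b0 mul0r addr0.
    over.
  by [].
have vC1 := vfield_combination r sb vEZ.
have vC2 := vfield_combination r sZb vE.
rewrite (form_congr eta_form oD sD (vfield_bracket oD vYD vZD) (vfield_vadd vC1 vC2) _ Dp).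
  rewrite (form_add eta_form oD sD vC1 vC2 Dp).
  rewrite (form_combination r eta_form oD sD sb vEZ Dp).
  rewrite (form_combination r eta_form oD sD sZb vE Dp).
  rewrite big1 ?add0r => [|i _]; last by rewrite b0 mul0r.
  by under eq_bigr do rewrite mulNr; rewrite sumrN Zeta oppr0.
move=> q Dq k sk; rewrite /bracket (YE _ _ Dq (vfield_smooth oD vZD Dq sk)).
rewrite -(vfield_near_eq vZD Dq (f := fun q => \sum_(i <- r) b i q * E i k q)).
- rewrite (vfield_sum vZD)//.
    rewrite /vadd /combination -sumrB -big_split /=; apply: eq_bigr => i _.
    rewrite (vfieldM vZD Dq (sb i q Dq) (vfield_smooth oD (vE i) Dq sk)).
    ring.
  by move=> i; apply: smooth_atM; [exact: sb|exact: (vfield_smooth oD (vE i) Dq sk)].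
- apply: smooth_at_sum => i; apply: smooth_atM; first exact: sb.
  exact: (vfield_smooth oD (vE i) Dq sk).
- apply: filterS2 (near_open oD Dq) (smooth_at_near sk) => q' Dq' sk'.
  by rewrite (YE _ _ Dq' sk').
Qed.

Lemma dform_congr U U' eta X X' Y Y' p : is_form U' eta -> open U -> U `<=` U' ->
  vfield U X -> vfield U X' -> vfield U Y -> vfield U Y' ->
  veq U X X' -> veq U Y Y' -> U p -> dform eta X Y p = dform eta X' Y' p.
Proof.
move=> eta_form oU sU vX vX' vY vY' XX YY Up; rewrite /dform.
have sX := form_smooth eta_form oU sU vX; have sY := form_smooth eta_form oU sU vY.
have half Z Z' W W' : vfield U Z -> vfield U Z' -> vfield U W -> vfield U W' ->
    veq U Z Z' -> veq U W W' -> Z (eta W) p = Z' (eta W') p.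
  move=> vZ vZ' vW vW' ZZ WW.
  have sW := form_smooth eta_form oU sU vW Up.
  rewrite ZZ//; apply: (vfield_near_eq vZ' Up sW).
  apply: filterS (near_open oU Up) => q Uq.
  exact: (form_congr eta_form oU sU vW vW' WW Uq).
congr (_ - _ - _); [exact: half|exact: half|].
apply: (form_congr eta_form oU sU) => //; try exact: vfield_bracket.
exact: bracket_veq.
Qed.

End FormBracket.

(** * The structure equations of the adapted frame *)

Section Frame.
Variables (R : realType) (M : bmanifold3 R) (S : pseudohermitian M) (T : op M).
Hypothesis hT : is_reeb S T.
Variable nabla : op M -> op M -> op M.
Hypothesis hnabla : is_tanaka_webster S T nabla.
Variables (U : set M) (e1 e2 : op M) (rho : M -> R) (expn : M -> R -> M)
  (len : M -> R).
Hypothesis hF : adapted_frame S T nabla U e1 e2 rho expn len.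
Variable omega : op M -> M -> R.
Hypothesis homega : is_connection_form nabla U e1 e2 omega.
Variables a1 a2 : M -> R.
Hypothesis ha : torsion_coefficients T nabla U e1 e2 a1 a2.

Implicit Types (p q : M) (f g : M -> R).

Let oU : open U := af_open hF.
Let v1 : vfield U e1 := (af_e1 hF).1.
Let v2 : vfield U e2 := (af_e2 hF).1.
Let subT : U `<=` setT. Proof. by []. Qed.
Let subU : U `<=` U. Proof. by []. Qed.

Lemma reeb_vfieldU : vfield U T.
Proof. exact: vfieldS (reeb_vfield hT). Qed.
Let vT := reeb_vfieldU.
Let thf := theta_form S.
Let cff := cf_form homega.

Lemma theta_e1 p : U p -> theta S e1 p = 0. Proof. exact: (af_e1 hF).2. Qed.
Lemma theta_e2 p : U p -> theta S e2 p = 0. Proof. exact: (af_e2 hF).2. Qed.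

(** The frame is normalised by [|e1| = 1] and [e2 = J e1], which reads
    [d theta(e1, e2) = 2]. *)
Lemma dtheta_e1_e2 p : U p -> dform (theta S) e1 e2 p = 2.
Proof.
move=> Up; pose H := hpart S T e1.
have s1 : smooth_on U (theta S e1) by exact: (form_smooth thf oU subT v1).
have vH : vfield U H.
  by apply: vfield_vadd => //; apply/vfield_vopp/vfield_vscale.
have He1 : veq U H e1.
  move=> q Uq f sf; rewrite /H /hpart /vadd /vopp /vscale theta_e1//.
  by rewrite mul0r subr0.
have hH : horizontal (theta S) U H.
  split=> // q Uq; rewrite (form_congr thf oU subT vH v1 He1 Uq); exact: theta_e1.
have JH2 : veq U (Jop S H) e2.
  move=> q Uq f sf; rewrite (J_congr oU hH (af_e1 hF) He1 Uq sf).
  exact: (af_J hF).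
have vJ : vfield U (Jop S H) by exact: (J_horizontal oU hH).1.
have := af_unit hF Up; rewrite /gmetric theta_e1// mul0r add0r.
rewrite -/H (dform_congr thf oU subT vH v1 vJ v2 He1 JH2 Up) => E.
by rewrite -[LHS]mul1r -[X in X * _](@divff _ (2 : R))// -mulrA E mulr1.
Qed.

Lemma theta_bracket_e1_e2 p : U p -> theta S (bracket e1 e2) p = -2.
Proof.
move=> Up; have := dtheta_e1_e2 Up; rewrite /dform.
rewrite (vfield_eq0 oU v1 Up theta_e2) (vfield_eq0 oU v2 Up theta_e1) subrr sub0r.
by move=> <-; rewrite opprK.
Qed.

(** Otherwise [[e1, e2]] would be horizontal at [p] by tensoriality, whereas its
    [theta]-component is [-2]. *)
Lemma e1_neq0 p : U p -> exists2 k, smooth_at k p & e1 k p <> 0.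
Proof.
move=> Up; apply: contrapT => H.
have : theta S (bracket e1 e2) p = 0.
  apply: (form_bracket_eq0 thf oU subT v1 v2 theta_e1 Up) => k sk.
  by apply: contrapT => k0; apply: H; exists k.
by rewrite theta_bracket_e1_e2// => /eqP; rewrite oppr_eq0 pnatr_eq0.
Qed.

(** The geodesic equation reads [omega(e2) e1 = 0]. *)
Lemma omega_e2 p : U p -> omega e2 p = 0.
Proof.
move=> Up; have [k sk k0] := e1_neq0 Up.
have := af_geodesic hF Up sk; rewrite (cf_e2 homega oU subU v2 Up sk).
rewrite /vopp /vscale /vzero => /eqP; rewrite oppr_eq0 mulf_eq0 => /orP[/eqP//|/eqP].
by move/k0.
Qed.

Lemma comm_e1_e2 f p : U p -> smooth_at f p ->
  e1 (e2 f) p = e2 (e1 f) p - omega e1 p * e1 f p - 2 * T f p.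
Proof.
move=> Up sf.
have := tw_torsion_xi hnabla oU (af_e1 hF) (af_e2 hF) Up sf.
rewrite /torsion /vscale dtheta_e1_e2// (cf_e2 homega oU subU v1 Up sf).
rewrite (cf_e1 homega oU subU v2 Up sf) /vopp /vscale omega_e2// /bracket => <-.
ring.
Qed.

Lemma comm_T_e1 f p : U p -> smooth_at f p ->
  T (e1 f) p = e1 (T f) p - a1 p * e1 f p + (omega T p + a2 p) * e2 f p.
Proof.
move=> Up sf; have := ha.1 p Up f sf.
rewrite /torsion (cf_e1 homega oU subU vT Up sf) (tw_reeb hnabla oU v1 Up sf).
rewrite /bracket /vadd /vopp /vscale /vzero => E.
have -> : T (e1 f) p = e1 (T f) p + omega T p * e2 f p
    - (omega T p * e2 f p - 0 - (T (e1 f) p - e1 (T f) p)) by ring.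
by rewrite E; ring.
Qed.

Lemma comm_T_e2 f p : U p -> smooth_at f p ->
  T (e2 f) p = e2 (T f) p + (a2 p - omega T p) * e1 f p + a1 p * e2 f p.
Proof.
move=> Up sf; have := ha.2 p Up f sf.
rewrite /torsion (cf_e2 homega oU subU vT Up sf) (tw_reeb hnabla oU v2 Up sf).
rewrite /bracket /vadd /vopp /vscale /vzero => E.
have -> : T (e2 f) p = e2 (T f) p - omega T p * e1 f p
    - (- (omega T p * e1 f p) - 0 - (T (e2 f) p - e2 (T f) p)) by ring.
by rewrite E; ring.
Qed.

(** * Derivatives along the geodesics *)

Lemma velocity_right x s f : U x -> boundary x -> 0 <= s < len x ->
  smooth_at f (expn x s) ->
  (t - s)^-1 * (f (expn x t) - f (expn x s)) @[t --> s^'+] --> e2 f (expn x s).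
Proof.
move=> Ux bx sx sf A /(af_velocity hF Ux bx sx sf) HA.
have {}HA : \forall t \near s, t != s -> 0 <= t < len x ->
    A ((t - s)^-1 * (f (expn x t) - f (expn x s))) by exact: HA.
have tl : \forall t \near s, t < len x.
  by apply: lt_nbhsl; case/andP: sx.
suff : \forall t \near s, s < t -> A ((t - s)^-1 * (f (expn x t) - f (expn x s))).
  by [].
apply: filterS2 HA tl => t HA tl st; apply: HA; first by rewrite gt_eqF.
by rewrite tl andbT ltW// (le_lt_trans _ st)//; case/andP: sx.
Qed.

Lemma velocity_derive x s f : U x -> boundary x -> 0 < s < len x ->
  smooth_at f (expn x s) ->
  is_derive s 1 (fun t => f (expn x t)) (e2 f (expn x s)).
Proof.
move=> Ux bx /andP[s0 sl] sf.
have sx : 0 <= s < len x by rewrite ltW.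
have cv : h^-1 *: (((fun t => f (expn x t)) \o shift s) (h *: 1) - f (expn x s))
    @[h --> 0^'] --> e2 f (expn x s).
  move=> A /(af_velocity hF Ux bx sx sf) HA.
  have {}HA : \forall t \near s, t != s -> 0 <= t < len x ->
      A ((t - s)^-1 * (f (expn x t) - f (expn x s))) by exact: HA.
  have {}HA : \forall t \near s, t != s ->
      A ((t - s)^-1 * (f (expn x t) - f (expn x s))).
    apply: filterS3 HA (lt_nbhsl sl) (lt_nbhsr s0) => t HA tl t0 ts.
    by apply: HA => //; rewrite ltW.
  suff : \forall h \near (0 : R), h != 0 -> A (h^-1 *
    (f (expn x (h *: 1 + s)) - f (expn x s))) by [].
  move: HA; rewrite (near_shift 0) subr0; apply: filterS => h /= HA h0.
  by move: HA; rewrite addrK [h *: 1]mulr1; apply; rewrite -subr_eq0 addrK.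
by apply: DeriveDef; [apply/cvg_ex; exists (e2 f (expn x s))|exact: cvg_lim cv].
Qed.

(** Every point of [U] lies on one of the geodesics, and [e2] is their velocity,
    so that the growth of [f] along them determines [e2 f]. *)
Lemma e2_affine f (l : R) p : U p -> smooth_at f p ->
  (forall x s t, U x -> boundary x -> 0 <= s < len x -> 0 <= t < len x ->
     f (expn x t) - f (expn x s) = (t - s) * l) ->
  e2 f p = l.
Proof.
move=> Up; have [x [s [Ux bx sx ->]]] := af_cover hF Up => sf fl.
have cf := velocity_right Ux bx sx sf; have /andP[s0 sl] := sx.
suff cl : (t - s)^-1 * (f (expn x t) - f (expn x s)) @[t --> s^'+] --> l.
  exact: cvg_unique cf cl.
apply: cvg_near_cst; near=> t.
rewrite (fl x s t)//; last first.
  apply/andP; split; last by near: t; exact: nbhs_right_lt.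
  rewrite (le_trans s0)//; near: t; exact: nbhs_right_ge.
rewrite mulrA mulVf ?mul1r// subr_eq0.
by near: t; apply: filterS (nbhs_right_gt s) => t st; rewrite gt_eqF.
Unshelve. all: by end_near. Qed.

Lemma e2_rho p : U p -> e2 rho p = 1.
Proof.
move=> Up; apply: e2_affine => //; first exact: (af_rho_smooth hF).
by move=> x s t Ux bx sx tx; rewrite !(af_rho hF)// mulr1.
Qed.

Lemma e2_coefficient c p : boundary_coefficient U expn len c -> U p ->
  e2 c p = 0.
Proof.
move=> [sc cc] Up; apply: e2_affine => //; first exact: sc.
by move=> x s t Ux bx sx tx; rewrite !cc// subrr mulr0.
Qed.

Lemma rho_boundary x : U x -> boundary x -> rho x = 0.
Proof.
move=> Ux bx; have l0 : 0 <= (0 : R) < len x by rewrite lexx (af_len hF).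
by have := af_rho hF Ux bx l0; rewrite (af_start hF).
Qed.

(** * Smoothness of the coefficients *)

Lemma vfield_eq_on X F G p : vfield U X -> U p -> (forall q, U q -> F q = G q) ->
  smooth_at G p -> X F p = X G p.
Proof.
move=> vX Up FG sG; apply/esym/(vfield_near_eq vX Up sG).
by apply: filterS (near_open oU Up) => q Uq; exact: esym (FG q Uq).
Qed.

Lemma smooth_on_eq F G : (forall q, U q -> F q = G q) -> smooth_on U G ->
  smooth_on U F.
Proof.
move=> FG sG p Up; apply: smooth_at_near_eq (sG p Up).
by apply: filterS (near_open oU Up) => q Uq; exact: esym (FG q Uq).
Qed.

Lemma smooth_e1 F p : U p -> smooth_at F p -> smooth_at (e1 F) p.
Proof. by move=> Up sF; apply: (vfield_smooth oU v1 Up sF). Qed.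
Lemma smooth_e2 F p : U p -> smooth_at F p -> smooth_at (e2 F) p.
Proof. by move=> Up sF; apply: (vfield_smooth oU v2 Up sF). Qed.
Lemma smooth_T F p : U p -> smooth_at F p -> smooth_at (T F) p.
Proof. by move=> Up sF; apply: (vfield_smooth oU vT Up sF). Qed.

Lemma smooth_omega1 : smooth_on U (omega e1).
Proof. exact: (form_smooth cff oU subU v1). Qed.
Lemma smooth_omegaT : smooth_on U (omega T).
Proof. exact: (form_smooth cff oU subU vT). Qed.
Let sA := smooth_omega1.
Let sw := smooth_omegaT.
Let srho := af_rho_smooth hF.

Ltac smooth := repeat first
  [ assumption | exact: smooth_at_cst | apply: smooth_atB | apply: smooth_atD
  | apply: smooth_atN
  | apply: smooth_atM | apply: smooth_atX | apply: smooth_e1 | apply: smooth_e2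
  | apply: smooth_T | apply: sA | apply: sw | apply: srho ].

(** The commutator of [e1 - e1(rho) e2] with [e2] is [-2 T] modulo the contact
    planes, which tensoriality forbids where the field vanishes. *)
Lemma e1_horizontal_neq0 p : U p ->
  exists2 k, smooth_at k p & e1 k p - e1 rho p * e2 k p != 0.
Proof.
move=> Up; apply: contrapT => H.
pose Y := vadd e1 (vopp (vscale (e1 rho) e2)).
have sf : smooth_on U (e1 rho) by move=> q Uq; smooth.
have vs := vfield_vscale sf v2.
have vY : vfield U Y by apply: vfield_vadd => //; exact: vfield_vopp.
have veqY : veq U Y (vadd (vscale (fun q => - e1 rho q) e2) e1).
  by move=> q Uq k sk; rewrite /Y /vadd /vopp /vscale mulNr addrC.
have snf : smooth_on U (fun q => - e1 rho q) by move=> q Uq; smooth.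
have tY q : U q -> theta S Y q = 0.
  move=> Uq; rewrite (form_congr thf oU subT vY _ veqY Uq).
    by rewrite (form_linear thf oU subT v2 v1 snf Uq) theta_e1// theta_e2// mulr0 addr0.
  by apply: vfield_vadd => //; exact: vfield_vscale.
have : theta S (bracket Y e2) p = 0.
  apply: (form_bracket_eq0 thf oU subT vY v2 tY Up) => k sk.
  rewrite /Y /vadd /vopp /vscale.
  by apply: contrapT => k0; apply: H; exists k => //; apply/eqP.
have sff : smooth_on U (e2 (e1 rho)) by move=> q Uq; smooth.
have v12 := vfield_bracket oU v1 v2.
have E : veq U (bracket Y e2) (vadd (vscale (e2 (e1 rho)) e2) (bracket e1 e2)).
  move=> q Uq k sk; rewrite /bracket /vadd /vscale.
  have -> : e2 (Y k) q = e2 (fun q => e1 k q - e1 rho q * e2 k q) q by [].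
  rewrite (vfieldB v2)//; [|by smooth..].
  rewrite (vfieldM v2)//; [|by smooth..].
  by rewrite /Y /vadd /vopp /vscale; ring.
rewrite (form_congr thf oU subT (vfield_bracket oU vY v2) _ E Up); last first.
  by apply: vfield_vadd => //; exact: vfield_vscale.
rewrite (form_linear thf oU subT v2 v12 sff Up) theta_e2// mulr0 add0r.
by rewrite theta_bracket_e1_e2// => /eqP; rewrite oppr_eq0 pnatr_eq0.
Qed.

(** [a1] and [a2] are the coordinates of a smooth field in the frame [e1], [e2];
    Cramer's rule with [rho] and a function detecting [e1 - e1(rho) e2] recovers
    them smoothly. *)
Lemma smooth_a1_a2 : smooth_on U a1 /\ smooth_on U a2.
Proof.
pose X h q := e1 (T h) q - T (e1 h) q + omega T q * e2 h q.
have XE h q : U q -> smooth_at h q -> X h q = a1 q * e1 h q - a2 q * e2 h q.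
  by move=> Uq sh; rewrite /X comm_T_e1//; ring.
have sX h q : U q -> smooth_at h q -> smooth_at (X h) q by move=> Uq sh; smooth.
have sa1 : smooth_on U a1.
  move=> p Up; have [k sk k0] := e1_horizontal_neq0 Up.
  pose den q := e1 k q - e1 rho q * e2 k q.
  have sden : smooth_at den p by smooth.
  have near_den : \forall q \near p, den q != 0.
    exact: cvgr_neq0 (smooth_at_continuous sden) k0.
  apply: (@smooth_at_near_eq _ _ (fun q => (X k q - X rho q * e2 k q) * (den q)^-1)).
    apply: filterS3 near_den (near_open oU Up) (smooth_at_near sk) => q d0 Uq skq.
    rewrite (XE k)// (XE rho)//; last by smooth.
    rewrite e2_rho//; apply: (mulIf d0); rewrite mulfVK// /den; ring.
  apply: smooth_atM; last exact: smooth_atV.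
  apply: smooth_atB; first exact: sX.
  by apply: smooth_atM; [apply: sX; smooth|smooth].
split=> //; apply: (@smooth_on_eq _ (fun q => a1 q * e1 rho q - X rho q)).
  by move=> q Uq; rewrite (XE rho)//; [rewrite e2_rho//; ring|smooth].
by move=> p Up; apply: smooth_atB; [smooth; exact: sa1|apply: sX => //; smooth].
Qed.
Let sa1 := smooth_a1_a2.1.
Let sa2 := smooth_a1_a2.2.

Variables W Rc : M -> R.
Hypothesis hW : webster_curvature U e1 e2 omega W.
Hypothesis hRc : forall p, U p -> Rc p = 2 * W p.

(** The definition of the curvature, with [[e1, e2] = - omega(e1) e1 - 2 T]. *)
Lemma e2_omega1 p : U p ->
  e2 (omega e1) p = Rc p + omega e1 p ^+ 2 + 2 * omega T p.
Proof.
move=> Up; have := hW Up.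
rewrite /dform (vfield_eq0 oU v1 Up omega_e2) sub0r hRc// => E.
have sNA : smooth_on U (fun q => - omega e1 q) by move=> q Uq; smooth.
have s2 : smooth_on U (fun=> -2 : R) by move=> q Uq; smooth.
have v2T := vfield_vscale s2 vT.
have B : veq U (bracket e1 e2)
    (vadd (vscale (fun q => - omega e1 q) e1) (vscale (fun=> -2) T)).
  by move=> q Uq f sf; rewrite /bracket comm_e1_e2// /vadd /vscale; ring.
move: E; rewrite (form_congr cff oU subU (vfield_bracket oU v1 v2) _ B Up); last first.
  by apply: vfield_vadd => //; exact: vfield_vscale.
rewrite (form_linear cff oU subU v1 v2T sNA Up) (form_scale cff oU subU vT s2 Up) => E.
have -> : e2 (omega e1) p = - (- e2 (omega e1) p -
  (- omega e1 p * omega e1 p + -2 * omega T p)) + omega e1 p ^+ 2 + 2 * omega T p by ring.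
by rewrite E opprK.
Qed.

Lemma smooth_Rc : smooth_on U Rc.
Proof.
apply: (@smooth_on_eq _ (fun q => e2 (omega e1) q - omega e1 q ^+ 2 - 2 * omega T q)).
  by move=> q Uq; rewrite e2_omega1//; ring.
by move=> p Up; smooth.
Qed.
Let sRc := smooth_Rc.

(** * The derivatives of [rho] *)

Lemma e2_e1_rho p : U p -> e2 (e1 rho) p = omega e1 p * e1 rho p + 2 * T rho p.
Proof.
move=> Up; have := comm_e1_e2 Up (srho Up).
rewrite (vfield_eq_on v1 Up e2_rho (smooth_at_cst 1 (p := p))) (vfield_cst v1 1 Up).
move=> E; apply/eqP; rewrite -subr_eq0 opprD addrA -E.
by [].
Qed.

Lemma e2_T_rho p : U p ->
  e2 (T rho) p = (omega T p - a2 p) * e1 rho p - a1 p.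
Proof.
move=> Up; have := comm_T_e2 Up (srho Up).
rewrite (vfield_eq_on vT Up e2_rho (smooth_at_cst 1 (p := p))) (vfield_cst vT 1 Up).
rewrite e2_rho// mulr1 => E; apply/eqP; rewrite -subr_eq0 E; apply/eqP; ring.
Qed.

Lemma T_e1_rho p : U p ->
  T (e1 rho) p = e1 (T rho) p - a1 p * e1 rho p + (omega T p + a2 p).
Proof. by move=> Up; rewrite comm_T_e1 ?e2_rho ?mulr1//; exact: srho. Qed.

(** * Jets along the geodesics *)

(** The value at [x] and the first three derivatives along [e2]; products follow
    the Leibniz rule, so the jets form the ring of polynomials in one variable
    truncated at order four. *)
Definition jet x F (d0 d1 d2 d3 : R) :=
  smooth_on U F /\ [/\ F x = d0, e2 F x = d1, e2 (e2 F) x = d2 &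
    e2 (e2 (e2 F)) x = d3].

Lemma jet_self x F : smooth_on U F ->
  jet x F (F x) (e2 F x) (e2 (e2 F) x) (e2 (e2 (e2 F)) x).
Proof. by []. Qed.

Lemma jet_val x F d0 d1 d2 d3 c0 c1 c2 c3 : jet x F d0 d1 d2 d3 ->
  d0 = c0 -> d1 = c1 -> d2 = c2 -> d3 = c3 -> jet x F c0 c1 c2 c3.
Proof. by move=> j <- <- <- <-. Qed.

Lemma jet_eq x F G d0 d1 d2 d3 : U x -> (forall q, U q -> F q = G q) ->
  jet x G d0 d1 d2 d3 -> jet x F d0 d1 d2 d3.
Proof.
move=> Ux FG [sG [G0 G1 G2 G3]].
have E1 q : U q -> e2 F q = e2 G q.
  by move=> Uq; apply: (vfield_eq_on v2 Uq FG); apply: sG.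
have E2 q : U q -> e2 (e2 F) q = e2 (e2 G) q.
  by move=> Uq; apply: (vfield_eq_on v2 Uq E1); apply: smooth_e2 => //; apply: sG.
have E3 q : U q -> e2 (e2 (e2 F)) q = e2 (e2 (e2 G)) q.
  by move=> Uq; apply: (vfield_eq_on v2 Uq E2); do 2!apply: smooth_e2 => //; apply: sG.
split; first exact: smooth_on_eq FG sG.
by split; rewrite -?G0 -?G1 -?G2 -?G3; [exact: FG|exact: E1|exact: E2|exact: E3].
Qed.

Lemma jet_cst x (a : R) : U x -> jet x (fun=> a) a 0 0 0.
Proof.
move=> Ux; have C (b : R) q : U q -> e2 (fun=> b) q = 0 by exact: (vfield_cst v2 b).
have E2 q : U q -> e2 (e2 (fun=> a)) q = 0 by move=> Uq; exact: (vfield_eq0 oU v2 Uq (C a)).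
have E3 q : U q -> e2 (e2 (e2 (fun=> a))) q = 0 by move=> Uq; exact: (vfield_eq0 oU v2 Uq E2).
split; first by move=> q Uq; exact: smooth_at_cst.
by split=> //; [exact: C|exact: E2|exact: E3].
Qed.

Lemma smooth_on_e2 F : smooth_on U F -> smooth_on U (e2 F).
Proof. by move=> sF q Uq; apply: smooth_e2 => //; exact: (sF q Uq). Qed.

Lemma smooth_onD F G : smooth_on U F -> smooth_on U G ->
  smooth_on U (fun q => F q + G q).
Proof.
by move=> sF sG q Uq; apply: smooth_atD; [exact: (sF q Uq)|exact: (sG q Uq)].
Qed.

Lemma smooth_onM F G : smooth_on U F -> smooth_on U G ->
  smooth_on U (fun q => F q * G q).
Proof.
by move=> sF sG q Uq; apply: smooth_atM; [exact: (sF q Uq)|exact: (sG q Uq)].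
Qed.

Lemma e2D F G q : smooth_on U F -> smooth_on U G -> U q ->
  e2 (fun q => F q + G q) q = e2 F q + e2 G q.
Proof. by move=> sF sG Uq; exact: (vfieldD v2 Uq (sF q Uq) (sG q Uq)). Qed.

Lemma e2M F G q : smooth_on U F -> smooth_on U G -> U q ->
  e2 (fun q => F q * G q) q = e2 F q * G q + F q * e2 G q.
Proof. by move=> sF sG Uq; exact: (vfieldM v2 Uq (sF q Uq) (sG q Uq)). Qed.

Lemma jetD x F G d0 d1 d2 d3 c0 c1 c2 c3 : U x ->
  jet x F d0 d1 d2 d3 -> jet x G c0 c1 c2 c3 ->
  jet x (fun q => F q + G q) (d0 + c0) (d1 + c1) (d2 + c2) (d3 + c3).
Proof.
move=> Ux [sF [<- <- <- <-]] [sG [<- <- <- <-]].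
have [sF1 sG1] := (smooth_on_e2 sF, smooth_on_e2 sG).
have [sF2 sG2] := (smooth_on_e2 sF1, smooth_on_e2 sG1).
have E1 q : U q -> _ := e2D sF sG.
have E2 q : U q -> e2 (e2 (fun q => F q + G q)) q = e2 (e2 F) q + e2 (e2 G) q.
  move=> Uq; rewrite (vfield_eq_on v2 Uq E1) ?e2D//.
  exact: (smooth_onD sF1 sG1 Uq).
have E3 q : U q -> e2 (e2 (e2 (fun q => F q + G q))) q =
    e2 (e2 (e2 F)) q + e2 (e2 (e2 G)) q.
  move=> Uq; rewrite (vfield_eq_on v2 Uq E2) ?e2D//.
  exact: (smooth_onD sF2 sG2 Uq).
split; first exact: smooth_onD.
by split=> //; [exact: E1|exact: E2|exact: E3].
Qed.

Lemma jetM x F G d0 d1 d2 d3 c0 c1 c2 c3 : U x ->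
  jet x F d0 d1 d2 d3 -> jet x G c0 c1 c2 c3 ->
  jet x (fun q => F q * G q) (d0 * c0) (d1 * c0 + d0 * c1)
    (d2 * c0 + 2 * (d1 * c1) + d0 * c2)
    (d3 * c0 + 3 * (d2 * c1) + 3 * (d1 * c2) + d0 * c3).
Proof.
move=> Ux [sF [<- <- <- <-]] [sG [<- <- <- <-]].
have [sF1 sG1] := (smooth_on_e2 sF, smooth_on_e2 sG).
have [sF2 sG2] := (smooth_on_e2 sF1, smooth_on_e2 sG1).
have M1 := smooth_onM sF1 sG; have M2 := smooth_onM sF sG1.
have M3 := smooth_onM sF2 sG; have M4 := smooth_onM sF1 sG1.
have M5 := smooth_onM sF sG2.
have E1 q : U q -> _ := e2M sF sG.
have E2 q : U q -> e2 (e2 (fun q => F q * G q)) q =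
    (e2 (e2 F) q * G q + e2 F q * e2 G q) + (e2 F q * e2 G q + F q * e2 (e2 G) q).
  move=> Uq; rewrite (vfield_eq_on v2 Uq E1); last exact: (smooth_onD M1 M2 Uq).
  by rewrite (e2D M1 M2 Uq) (e2M sF1 sG Uq) (e2M sF sG1 Uq).
have E3 : e2 (e2 (e2 (fun q => F q * G q))) x =
    ((e2 (e2 (e2 F)) x * G x + e2 (e2 F) x * e2 G x)
      + (e2 (e2 F) x * e2 G x + e2 F x * e2 (e2 G) x)) +
    ((e2 (e2 F) x * e2 G x + e2 F x * e2 (e2 G) x) +
      (e2 F x * e2 (e2 G) x + F x * e2 (e2 (e2 G)) x)).
  have D1 := smooth_onD M3 M4; have D2 := smooth_onD M4 M5.
  rewrite (vfield_eq_on v2 Ux E2); last exact: (smooth_onD D1 D2 Ux).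
  rewrite (e2D D1 D2 Ux) (e2D M3 M4 Ux) (e2D M4 M5 Ux).
  by rewrite (e2M sF2 sG Ux) (e2M sF1 sG1 Ux) (e2M sF sG2 Ux).
split; first exact: smooth_onM.
by split=> //; rewrite ?(E1 x Ux) ?(E2 x Ux) ?E3; ring.
Qed.

Lemma jetN x F d0 d1 d2 d3 : U x -> jet x F d0 d1 d2 d3 ->
  jet x (fun q => - F q) (- d0) (- d1) (- d2) (- d3).
Proof.
move=> Ux jF; apply: (@jet_eq _ _ (fun q => (fun=> -1) q * F q)) => //.
  by move=> q _; rewrite mulN1r.
by apply: jet_val (jetM Ux (jet_cst (-1) Ux) jF) _ _ _ _; ring.
Qed.

Lemma jet_rho x : U x -> boundary x -> jet x rho 0 1 0 0.
Proof.
move=> Ux bx; have [_ [C0 C1 C2 _]] := jet_cst 1 Ux.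
have [s1 E] : smooth_on U (fun=> 1 : R) /\ forall q, U q -> e2 rho q = (fun=> 1) q.
  by split=> [q Uq|q]; [exact: smooth_at_cst|exact: e2_rho].
split; first exact: srho.
have E2 q : U q -> e2 (e2 rho) q = e2 (fun=> 1) q.
  by move=> Uq; apply: (vfield_eq_on v2 Uq E); exact: smooth_at_cst.
have E3 : e2 (e2 (e2 rho)) x = e2 (e2 (fun=> 1)) x.
  by apply: (vfield_eq_on v2 Ux E2); apply: smooth_e2 => //; exact: smooth_at_cst.
by split; [exact: rho_boundary|exact: e2_rho|rewrite E2|rewrite E3].
Qed.

Lemma jet_coefficient x c : U x -> boundary_coefficient U expn len c ->
  jet x c (c x) 0 0 0.
Proof.
move=> Ux bc; have E1 q : U q -> e2 c q = 0 by exact: e2_coefficient.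
have E2 q : U q -> e2 (e2 c) q = 0 by move=> Uq; exact: (vfield_eq0 oU v2 Uq E1).
have E3 q : U q -> e2 (e2 (e2 c)) q = 0 by move=> Uq; exact: (vfield_eq0 oU v2 Uq E2).
by split; [exact: bc.1|split=> //; [exact: E1|exact: E2|exact: E3]].
Qed.

(** * The equation for the polynomial part of the expansion *)

Variable alpha : M -> R.
Hypothesis halpha : is_alpha T U e2 alpha.
Variables v w z : M -> R.
Hypotheses (bv : boundary_coefficient U expn len v)
  (bw : boundary_coefficient U expn len w)
  (bz : boundary_coefficient U expn len z).
Let sv : smooth_on U v := bv.1.
Let sw' : smooth_on U w := bw.1.
Let sz : smooth_on U z := bz.1.

Definition polynomial_part : M -> R := fun q =>
  rho q + v q * rho q ^+ 2 + w q * rho q ^+ 3 + z q * rho q ^+ 4.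
Local Notation P := polynomial_part.

Definition defect (y : M -> R) : M -> R := fun q =>
  dP_normsq e1 e2 y q - 2^-1 * (y q * laplP e1 e2 omega y q)
    - 8^-1 * (Rc q * y q ^+ 2) - 1.

Ltac smoothP := repeat first
  [ assumption | exact: smooth_at_cst | apply: smooth_atB | apply: smooth_atD
  | apply: smooth_atN
  | apply: smooth_atM | apply: smooth_atX | apply: smooth_e1 | apply: smooth_e2
  | apply: smooth_T | apply: sA | apply: sw | apply: srho | apply: sv
  | apply: sw' | apply: sz | apply: sa1 | apply: sa2 | apply: sRc
  | apply: halpha.1 ].

Let N1 q := 1 + 2 * (v q * rho q) + 3 * (w q * (rho q * rho q))
  + 4 * (z q * (rho q * (rho q * rho q))).
Let N2 q := 2 * v q + 6 * (w q * rho q) + 12 * (z q * (rho q * rho q)).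

Lemma smooth_polynomial_part : smooth_on U P.
Proof. by move=> q Uq; rewrite /P; smoothP. Qed.

Ltac deriv V := rewrite ?(vfieldD V, vfieldN V, vfieldM V, vfieldX V, vfield_cst V);
  try (by smoothP).

Lemma e2_polynomial_part q : U q -> e2 P q = N1 q.
Proof.
move=> Uq; rewrite /P; deriv v2.
rewrite e2_rho// !(e2_coefficient _ Uq)// /N1 /=; ring.
Qed.

Lemma e2_e2_polynomial_part q : U q -> e2 (e2 P) q = N2 q.
Proof.
move=> Uq; rewrite (vfield_eq_on v2 Uq e2_polynomial_part) /N1; last by smoothP.
deriv v2.
rewrite e2_rho// !(e2_coefficient _ Uq)// /N2 /=; ring.
Qed.

Let L1 q := e1 v q * (rho q * rho q) + e1 w q * (rho q * (rho q * rho q))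
  + e1 z q * ((rho q * rho q) * (rho q * rho q)).

Lemma e1_polynomial_part q : U q -> e1 P q = e1 rho q * N1 q + L1 q.
Proof. by move=> Uq; rewrite /P; deriv v1; rewrite /N1 /L1 /=; ring. Qed.

Lemma e1_e1_polynomial_part q : U q -> e1 (e1 P) q =
  e1 (e1 rho) q * N1 q + e1 rho q * e1 rho q * N2 q
  + 2 * (e1 rho q * (2 * (e1 v q * rho q) + 3 * (e1 w q * (rho q * rho q))
      + 4 * (e1 z q * (rho q * (rho q * rho q)))))
  + (e1 (e1 v) q * (rho q * rho q) + e1 (e1 w) q * (rho q * (rho q * rho q))
      + e1 (e1 z) q * ((rho q * rho q) * (rho q * rho q))).
Proof.
move=> Uq; rewrite (vfield_eq_on v1 Uq e1_polynomial_part) /N1 /L1; last by smoothP.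
deriv v1; rewrite /N2 /=; ring.
Qed.

Section DefectJet.
Variable x : M.
Hypotheses (Ux : U x) (bx : boundary x).
Variables (f1 f2 f3 B1 B2 B3 A0 A1 A2 A3 R0 R1 R2 R3 : R).
Hypotheses (jf : jet x (e1 rho) 0 f1 f2 f3) (jB : jet x (e1 (e1 rho)) 0 B1 B2 B3)
  (jA : jet x (omega e1) A0 A1 A2 A3) (jR : jet x Rc R0 R1 R2 R3).

(* The Taylor coefficients of [laplP P]. *)
Let D0 := 2 * v x - A0.
Let D1 := B1 + 6 * w x - A1 - 2 * v x * A0.
Let D2 := B2 / 2 + e1 (e1 v) x + 4 * f1 * e1 v x + 2 * v x * B1
  + 2 * v x * f1 ^+ 2 + 12 * z x - A2 / 2 - 2 * v x * A1 - 3 * w x * A0.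

Ltac jets jc := repeat first
  [ eassumption | apply: jc | apply: jetN | apply: jetD | apply: jetM ].

(** The entry of index [k] is [k!] times the coefficient of [rho^k] in the
    equation. The coefficient of [rho^(k + 1)] in [P] enters it with the factor
    [(k + 1) (4 - k) / 2], which does not vanish for [k <= 3]: this is why [v], [w]
    and [z] are determined, and why a logarithm may appear at order five. *)
Lemma jet_defect : jet x (defect P) 0 (4 * v x - 2^-1 * D0)
  (2 * (6 * w x + 4 * v x ^+ 2 + f1 ^+ 2 - 2^-1 * (D1 + v x * D0) - 8^-1 * R0))
  (6 * (8 * z x + 12 * v x * w x + 2 * f1 * (f2 / 2 + 2 * v x * f1 + e1 v x)
     - 2^-1 * (D2 + v x * D1 + w x * D0) - 8^-1 * (R1 + 2 * v x * R0))).
Proof.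
pose E1 q := e1 rho q * N1 q + L1 q.
pose E11 q := e1 (e1 rho) q * N1 q + e1 rho q * e1 rho q * N2 q
  + 2 * (e1 rho q * (2 * (e1 v q * rho q) + 3 * (e1 w q * (rho q * rho q))
      + 4 * (e1 z q * (rho q * (rho q * rho q)))))
  + (e1 (e1 v) q * (rho q * rho q) + e1 (e1 w) q * (rho q * (rho q * rho q))
      + e1 (e1 z) q * ((rho q * rho q) * (rho q * rho q))).
pose Q q := rho q + v q * (rho q * rho q) + w q * (rho q * (rho q * rho q))
  + z q * ((rho q * rho q) * (rho q * rho q)).
pose G q := E1 q * E1 q + N1 q * N1 q
  + - (2^-1 * (Q q * (E11 q + N2 q + - (omega e1 q * N1 q))))
  + - (8^-1 * (Rc q * (Q q * Q q))) + -1.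
have jr := jet_rho Ux bx.
have jv := jet_coefficient Ux bv; have jw := jet_coefficient Ux bw.
have jz := jet_coefficient Ux bz.
have s1v : smooth_on U (e1 v) by move=> q Uq; smoothP.
have s1w : smooth_on U (e1 w) by move=> q Uq; smoothP.
have s1z : smooth_on U (e1 z) by move=> q Uq; smoothP.
have s11v : smooth_on U (e1 (e1 v)) by move=> q Uq; smoothP.
have s11w : smooth_on U (e1 (e1 w)) by move=> q Uq; smoothP.
have s11z : smooth_on U (e1 (e1 z)) by move=> q Uq; smoothP.
have j1v := jet_self x s1v; have j1w := jet_self x s1w; have j1z := jet_self x s1z.
have j11v := jet_self x s11v; have j11w := jet_self x s11w.
have j11z := jet_self x s11z.
have jc a := jet_cst a Ux.
apply: (@jet_eq _ _ G) => // [q Uq|].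
  rewrite /defect /dP_normsq /laplP e1_polynomial_part// e2_polynomial_part//.
  rewrite e1_e1_polynomial_part// e2_e2_polynomial_part// omega_e2//.
  by rewrite /G /E1 /E11 /Q /P /polynomial_part; ring.
have jN1 : jet x N1 1 (2 * v x) (6 * w x) (24 * z x).
  by rewrite /N1; apply: jet_val; [jets jc|ring..].
have jN2 : jet x N2 (2 * v x) (6 * w x) (24 * z x) 0.
  by rewrite /N2; apply: jet_val; [jets jc|ring..].
have jQ : jet x Q 0 1 (2 * v x) (6 * w x).
  by rewrite /Q; apply: jet_val; [jets jc|ring..].
have [c1 jL1] : exists c, jet x L1 0 0 (2 * e1 v x) c.
  by eexists; rewrite /L1; apply: jet_val; [jets jc|ring|ring|ring|reflexivity].
have [c2 jE1] : exists c, jet x E1 0 f1 (f2 + 4 * v x * f1 + 2 * e1 v x) c.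
  by eexists; rewrite /E1; apply: jet_val; [jets jc|ring|ring|ring|reflexivity].
have [c3 jE11] : exists c, jet x E11 0 B1 (B2 + 4 * v x * B1 +
    4 * v x * f1 ^+ 2 + 8 * f1 * e1 v x + 2 * e1 (e1 v) x) c.
  by eexists; rewrite /E11; apply: jet_val; [jets jc|ring|ring|ring|reflexivity].
rewrite /G; apply: jet_val; [jets jc| | | |].
- by ring.
- by rewrite /D0; field.
- by rewrite /D1 /D0; field.
- by rewrite /D2 /D1 /D0; field.
Qed.

End DefectJet.

(** * Boundary values *)

Lemma e1_boundary F x : U x -> boundary x -> smooth_at F x ->
  (forall y, U y -> boundary y -> F y = 0) -> e1 F x = 0.
Proof.
move=> Ux bx sF F0; apply: (af_tangent hF Ux bx sF).
by apply: filterS (near_open oU Ux) => y Uy by'; exact: F0.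
Qed.

Lemma V_boundary F x : U x -> boundary x -> smooth_at F x ->
  (forall y, U y -> boundary y -> F y = 0) -> T F x + alpha x * e2 F x = 0.
Proof.
move=> Ux bx sF F0; apply: (halpha.2 x Ux bx F sF).
by apply: filterS (near_open oU Ux) => y Uy by'; exact: F0.
Qed.

Lemma e1_rho_boundary x : U x -> boundary x -> e1 rho x = 0.
Proof.
move=> Ux bx; apply: e1_boundary => //; first exact: (srho Ux).
exact: rho_boundary.
Qed.

Lemma T_rho_boundary x : U x -> boundary x -> T rho x = - alpha x.
Proof.
move=> Ux bx; have := V_boundary Ux bx (srho Ux) rho_boundary.
by rewrite e2_rho// mulr1 => /eqP; rewrite addr_eq0 => /eqP.
Qed.

Section AtBoundary.
Variable x : M.
Hypotheses (Ux : U x) (bx : boundary x).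
Local Notation f := (e1 rho).
Local Notation g := (T rho).
Local Notation A := (omega e1).

Let sf : smooth_at f x. Proof. by smoothP. Qed.
Let sg : smooth_at g x. Proof. by smoothP. Qed.
Let sal : smooth_at alpha x. Proof. by smoothP. Qed.
Let f0 : f x = 0 := e1_rho_boundary Ux bx.
Let g0 : g x = - alpha x := T_rho_boundary Ux bx.

Let e2f : e2 f x = - 2 * alpha x.
Proof. by rewrite e2_e1_rho// f0 g0; ring. Qed.
Let e2g : e2 g x = - a1 x.
Proof. by rewrite e2_T_rho// f0; ring. Qed.
Let e1f : e1 f x = 0.
Proof. by apply: e1_boundary => // y Uy by'; exact: e1_rho_boundary. Qed.
Let Tf : T f x = 2 * alpha x ^+ 2.
Proof.
have := V_boundary Ux bx sf e1_rho_boundary; rewrite e2f => E.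
by apply/eqP; rewrite -subr_eq0 -E; apply/eqP; ring.
Qed.
Let ga0 y : U y -> boundary y -> g y + alpha y = 0.
Proof. by move=> Uy by'; rewrite T_rho_boundary// addNr. Qed.
Let sga : smooth_at (fun q => g q + alpha q) x. Proof. by smoothP. Qed.
Let e1g : e1 g x = - e1 alpha x.
Proof.
have := e1_boundary Ux bx sga ga0; rewrite (vfieldD v1)// => /eqP.
by rewrite addr_eq0 => /eqP.
Qed.
Let Tg : T g x = - Vfield T e2 alpha alpha x + alpha x * a1 x.
Proof.
have := V_boundary Ux bx sga ga0; rewrite (vfieldD vT)// (vfieldD v2)// e2g.
rewrite /Vfield /vadd /vscale => E.
by apply/eqP; rewrite -subr_eq0 -E; apply/eqP; ring.
Qed.

(** This says that the bracket of [e1] and [V] is tangent to the boundary, as both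
    fields are. *)
Lemma omegaT_boundary : omega T x = e1 alpha x + 2 * alpha x ^+ 2 - a2 x.
Proof.
have := T_e1_rho Ux; rewrite Tf f0 e1g => ->; ring.
Qed.

(** The coefficient of [e2] in the Jacobi identity for [e1], [e2], [T], applied
    to [rho]; the coefficient of [e1] is multiplied by [e1 rho = 0]. *)
Lemma e2_omegaT_boundary :
  e2 (omega T) x = A x * (omega T x + a2 x) + e1 a1 x - e2 a2 x.
Proof.
have E1 : e2 (T f) x = T (e2 f) x - (a2 x - omega T x) * e1 f x - a1 x * e2 f x.
  by rewrite comm_T_e2//; ring.
rewrite (vfield_eq_on vT Ux e2_e1_rho) in E1; last by smoothP.
rewrite (vfield_eq_on v2 Ux T_e1_rho) in E1; last by smoothP.
have E2 : e2 (e1 g) x = e1 (e2 g) x + A x * e1 g x + 2 * T g x.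
  by rewrite comm_e1_e2//; ring.
rewrite (vfield_eq_on v1 Ux e2_T_rho) in E2; last by smoothP.
move: E1 E2; deriv v2; deriv v1; deriv vT.
rewrite e1f f0 e2f e1g Tf => E1 E2.
move: E1; rewrite E2 omegaT_boundary => /eqP; rewrite -subr_eq0 => /eqP E1.
apply/eqP; rewrite -subr_eq0; apply/eqP; apply: etrans _ E1; ring.
Qed.

Lemma jet_e1_rho : exists c, jet x f 0 (- 2 * alpha x)
  (- 2 * alpha x * A x - 2 * a1 x) c.
Proof.
exists (e2 (e2 (e2 f)) x); split; first by move=> q Uq; smoothP.
split=> //; rewrite (vfield_eq_on v2 Ux e2_e1_rho); last by smoothP.
by deriv v2; rewrite e2f e2g f0; ring.
Qed.

Let sB q : U q -> smooth_at (e1 f) q. Proof. by move=> Uq; smoothP. Qed.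

Let e2B q : U q ->
  e2 (e1 f) q = e1 A q * f q + 2 * (A q * e1 f q) + 2 * e1 g q + 2 * T f q.
Proof.
move=> Uq; have sfq : smooth_at f q by smoothP.
have -> : e2 (e1 f) q = e1 (e2 f) q + A q * e1 f q + 2 * T f q.
  by rewrite comm_e1_e2//; ring.
rewrite (vfield_eq_on v1 Uq e2_e1_rho); last by smoothP.
by deriv v1; ring.
Qed.

Lemma jet_e1_e1_rho : exists c, jet x (e1 f) 0
  (- 2 * e1 alpha x + 4 * alpha x ^+ 2)
  (- 2 * alpha x * e1 A x - 6 * A x * e1 alpha x + 12 * A x * alpha x ^+ 2
   - 2 * e1 a1 x - 8 * Vfield T e2 alpha alpha x + 12 * alpha x * a1 x) c.
Proof.
exists (e2 (e2 (e2 (e1 f))) x); split; first exact: sB.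
split=> //; first by rewrite e2B// f0 e1f e1g Tf; ring.
have E1 : e2 (T f) x = T (e2 f) x - (a2 x - omega T x) * e1 f x - a1 x * e2 f x.
  by rewrite comm_T_e2//; ring.
rewrite (vfield_eq_on vT Ux e2_e1_rho) in E1; last by smoothP.
have E2 : e2 (e1 g) x = e1 (e2 g) x + A x * e1 g x + 2 * T g x.
  by rewrite comm_e1_e2//; ring.
rewrite (vfield_eq_on v1 Ux e2_T_rho) in E2; last by smoothP.
rewrite (vfield_eq_on v2 Ux e2B); last by smoothP.
deriv v2; rewrite {}E1 {}E2; deriv v1; deriv vT.
rewrite e2B// f0 e1f e2f e1g Tf Tg.
by ring.
Qed.

Lemma jet_omega1 : exists c, jet x A (A x)
  (Rc x + A x ^+ 2 + 2 * omega T x)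
  (e2 Rc x + 2 * A x * (Rc x + A x ^+ 2 + 2 * omega T x)
   + 2 * (A x * (omega T x + a2 x) + e1 a1 x - e2 a2 x)) c.
Proof.
exists (e2 (e2 (e2 A)) x); split; first exact: sA.
split=> //; first exact: e2_omega1.
rewrite (vfield_eq_on v2 Ux e2_omega1); last by smoothP.
by deriv v2; rewrite e2_omega1// e2_omegaT_boundary /=; ring.
Qed.

End AtBoundary.

(** * Asymptotics along a geodesic *)

Section Asymptotics.
Variable x : M.
Hypotheses (Ux : U x) (bx : boundary x).

Let x0 : 0 <= (0 : R) < len x. Proof. by rewrite lexx (af_len hF). Qed.
Let ex0 : expn x 0 = x := af_start hF Ux bx.

(** The velocity condition is tested on the indicator function of the complement
    of a neighbourhood of [x], which is smooth at [x]: its difference quotient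
    would be unbounded if the geodesic left the neighbourhood for arbitrarily
    small parameters. *)
Lemma geodesic_continuous : expn x s @[s --> 0^'+] --> x.
Proof.
move=> N /= nN; pose f q : R := if `[<N q>] then 0 else 1.
have f0 : \forall q \near x, 0 = f q.
  by apply: filterS nN => q Nq; rewrite /f asboolT.
have sf : smooth_at f x := smooth_at_near_eq f0 (smooth_at_cst 0 (p := x)).
have e2f : e2 f x = 0.
  by rewrite -(vfield_near_eq v2 Ux (smooth_at_cst 0 (p := x)) f0) (vfield_cst v2).
have := velocity_right Ux bx x0; rewrite ex0 => /(_ f sf).
rewrite e2f -(nbhs_singleton f0) => /cvgr0_norm_lt /(_ 1 ltr01) lim.
suff : \forall s \near 0^'+, N (expn x s) by [].
have s0 := nbhs_right_gt (0 : R); have s1 := nbhs_right_lt (ltr01 : 0 < 1 :> R).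
apply: filterS3 lim s0 s1 => s; rewrite !subr0 /f => lim s0 s1.
case: asboolP lim => // _; rewrite mulr1 gtr0_norm ?invr_gt0// invf_lt1//.
by rewrite ltNge ltW.
Qed.

Lemma near_geodesic (Q : set M) : (\forall q \near x, Q q) ->
  \forall s \near 0^'+, Q (expn x s).
Proof. exact: geodesic_continuous. Qed.

Lemma near_lt_len : \forall s \near 0^'+, 0 < s < len x.
Proof.
have := nbhs_right_gt (0 : R); have := nbhs_right_lt (af_len hF Ux bx).
by apply: filterS2 => s -> ->.
Qed.

Lemma rho_geodesic s : 0 < s < len x -> rho (expn x s) = s.
Proof. by move=> /andP[s0 sl]; rewrite (af_rho hF)// (ltW s0). Qed.

Lemma near_geodesic_gt0 (Q : set M) : (\forall q \near x, 0 < rho q -> Q q) ->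
  \forall s \near 0^'+, Q (expn x s).
Proof.
move=> /near_geodesic; have := near_lt_len; apply: filterS2 => s sx.
by apply; rewrite rho_geodesic//; case/andP: sx.
Qed.

(** [F = (l + o(1)) s^n] along the geodesic. *)
Definition asym n F (l : R) := F (expn x s) / s ^+ n @[s --> 0^'+] --> l.

Lemma asym_eq n F G l : (\forall s \near 0^'+, F (expn x s) = G (expn x s)) ->
  asym n F l -> asym n G l.
Proof.
move=> FG; apply: cvg_trans; apply: near_eq_cvg.
by apply: filterS FG => s ->.
Qed.

Lemma asymD n F G l k : asym n F l -> asym n G k ->
  asym n (fun q => F q + G q) (l + k).
Proof.
move=> aF aG; rewrite /asym; under eq_fun do rewrite mulrDl.
exact: cvgD.
Qed.

Lemma asymM m n F G l k : asym m F l -> asym n G k ->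
  asym (m + n) (fun q => F q * G q) (l * k).
Proof.
move=> aF aG; rewrite /asym.
under eq_fun do rewrite exprD invfM mulrACA.
exact: cvgM.
Qed.

Lemma cvg_expr0 n : s ^+ n.+1 @[s --> (0 : R)^'+] --> (0 : R).
Proof.
apply: cvg_at_right_filter; rewrite -[X in _ --> X](expr0n R n.+1).
exact: exprn_continuous.
Qed.

Lemma asym_low m n F l : (m < n)%N -> asym n F l -> asym m F 0.
Proof.
move=> mn aF; rewrite /asym -[X in _ --> X](mulr0 l).
have c0 := cvg_expr0 (n - m.+1).
have : F (expn x s) / s ^+ n * s ^+ (n - m.+1).+1 @[s --> 0^'+] --> l * 0.
  exact: cvgM aF c0.
apply: cvg_trans; apply: near_eq_cvg; apply: filterS (nbhs_right_gt (0 : R)) => s s0.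
have sn : s != 0 by rewrite gt_eqF.
rewrite (subnSK mn) -{1}(subnK (ltnW mn)) exprD invfM mulrA mulrAC divfK//.
by rewrite expf_neq0.
Qed.

Lemma asym_smooth F : smooth_at F x -> asym 0 F (F x).
Proof.
move=> sF; rewrite /asym; under eq_fun do rewrite expr0 divr1.
exact: cvg_comp geodesic_continuous (smooth_at_continuous sF).
Qed.

Lemma asym_rho : asym 1 rho 1.
Proof.
apply: cvg_near_cst; apply: filterS near_lt_len => s sx.
by rewrite rho_geodesic// expr1 divff// gt_eqF//; case/andP: sx.
Qed.

Lemma asym_bound m n F (C : R) : (m < n)%N ->
  (\forall s \near 0^'+, `|F (expn x s)| <= C * s ^+ n) -> asym m F 0.
Proof.
move=> mn FC; rewrite /asym.
have c0 : C * s ^+ (n - m) @[s --> (0 : R)^'+] --> (0 : R).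
  rewrite -[X in _ --> X](mulr0 C) -(subnSK mn); apply: cvgM; first exact: cvg_cst.
  exact: cvg_expr0.
apply/cvgr0Pnorm_lt => e e0; have /cvgr0_norm_lt/(_ e e0) := c0.
apply: filterS3 FC (nbhs_right_gt (0 : R)) => s Fs s0; apply: le_lt_trans.
rewrite normrM normfV normrX (gtr0_norm s0) ler_pdivrMr ?exprn_gt0//.
rewrite (le_trans Fs)// -{1}(subnK (ltnW mn)) exprD mulrA.
by rewrite ler_wpM2r ?ler_norm// exprn_ge0// ltW.
Qed.

Lemma cvg_mul_ln : s * ln s @[s --> (0 : R)^'+] --> (0 : R).
Proof.
have csq : Num.sqrt s * 2 @[s --> (0 : R)^'+] --> (0 : R).
  have : Num.sqrt s * 2 @[s --> (0 : R)^'+] --> Num.sqrt (0 : R) * 2.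
    apply: cvg_at_right_filter.
    by apply: cvgM; [exact: sqrt_continuous|exact: cvg_cst].
  by rewrite sqrtr0 mul0r.
apply/cvgr0Pnorm_lt => e e0; have /cvgr0_norm_lt/(_ e e0) := csq.
have s0 := nbhs_right_gt (0 : R); have s1 := nbhs_right_lt (ltr01 : 0 < 1 :> R).
apply: filterS3 s0 s1 => s s0 s1; apply: le_lt_trans.
have q0 : 0 < Num.sqrt s by rewrite sqrtr_gt0.
have sE : s = Num.sqrt s ^+ 2 by rewrite sqr_sqrtr// ltW.
rewrite normrM (gtr0_norm s0) (ler0_norm (ln_le0 (ltW s1))).
rewrite (gtr0_norm (_ : 0 < Num.sqrt s * 2)) ?mulr_gt0//.
(* [- ln s = 2 ln (1 / sqrt s) <= 2 / sqrt s] *)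
have l1 : ln (Num.sqrt s)^-1 <= (Num.sqrt s)^-1.
  have := @le_ln1Dx R ((Num.sqrt s)^-1 - 1); rewrite addrCA subrr addr0 => H.
  apply: le_trans (H _) _; last by rewrite gerBl.
  by rewrite ltrBrDl subrr invr_gt0.
have l2 : - ln s = 2 * ln (Num.sqrt s)^-1.
  rewrite lnV ?posrE// mulrN; congr (- _).
  by rewrite {1}sE lnXn// mulr_natl.
rewrite l2 {1}sE expr2 -mulrA ler_wpM2l ?(ltW q0)// mulrCA -[leRHS]mulr1 ler_wpM2l//.
by rewrite -(divff (lt0r_neq0 q0)) ler_wpM2l ?(ltW q0).
Qed.

Lemma asym_rho_ln : asym 0 (fun q => rho q * ln (rho q)) 0.
Proof.
apply: cvg_trans cvg_mul_ln; apply: near_eq_cvg.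
apply: filterS near_lt_len => s sx.
by rewrite rho_geodesic// expr0 divr1.
Qed.

(** A function of order [rho^n] has [l = F^(n) / n!] as leading coefficient, by
    l'Hopital's rule; the derivative along the geodesic is [e2]. *)
Lemma asym_iter n G : smooth_on U G ->
  (forall j, (j < n)%N -> iter j e2 G x = 0) ->
  asym n G (iter n e2 G x / n`!%:R).
Proof.
elim: n G => [|n IH] G sG G0.
  by rewrite fact0 divr1; apply: asym_smooth; exact: (sG x Ux).
have aG' : asym n (e2 G) (iter n.+1 e2 G x / n`!%:R).
  rewrite iterSr; apply: IH; first exact: smooth_on_e2.
  by move=> j jn; rewrite -iterSr; exact: G0.
have dG s : s \in `]0, len x[ ->
    is_derive s 1 (fun s => G (expn x s)) (e2 G (expn x s)).
  rewrite in_itv /= => sx; apply: velocity_derive => //.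
  by apply: sG; apply: (af_stay hF) => //; case/andP: sx => /ltW -> ->.
have dX s : s \in `]0, len x[ ->
    is_derive s 1 (fun s => s ^+ n.+1 : R) (n.+1%:R * s ^+ n).
  move=> _; apply: DeriveDef; first exact: exprn_derivable.
  by rewrite exp_derive /= /GRing.scale /= mulr1.
have cG : G (expn x s) @[s --> 0^'+] --> 0.
  have := asym_smooth (sG x Ux); rewrite /asym.
  under eq_fun do rewrite expr0 divr1.
  by have /= -> := G0 0%N isT.
have lE : iter n.+1 e2 G x / (n.+1)`!%:R = (iter n.+1 e2 G x / n`!%:R) / n.+1%:R.
  by rewrite factS mulnC natrM invfM mulrA.
rewrite lE; apply: (lhopital_at_right (af_len hF Ux bx) dG dX cG).
- exact: cvg_expr0.
- move=> s; rewrite in_itv /= => /andP[s0 _].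
  by rewrite mulf_neq0 ?expf_neq0 ?gt_eqF// ltr0n.
- have : e2 G (expn x s) / s ^+ n * n.+1%:R^-1 @[s --> 0^'+] -->
      iter n.+1 e2 G x / n`!%:R / n.+1%:R by apply: cvgM aG' _; exact: cvg_cst.
  by under eq_fun do rewrite -mulrA -invfM (mulrC (_ ^+ _)).
Qed.

Lemma asym0_iter n G : smooth_on U G -> asym n G 0 ->
  forall j, (j <= n)%N -> iter j e2 G x = 0.
Proof.
move=> sG aG; elim/ltn_ind => j IH jn.
have aj := asym_iter sG (fun i ij => IH i ij (leq_trans (ltnW ij) jn)).
have a0 : asym j G 0.
  by move: jn; rewrite leq_eqVlt => /orP[/eqP ->//|jn]; exact: asym_low aG.
have E : iter j e2 G x / j`!%:R = 0 by exact: cvg_unique aj a0.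
have jn0 : j`!%:R != 0 :> R by rewrite pnatr_eq0 -lt0n fact_gt0.
by rewrite -(divfK jn0 (iter j e2 G x)) E mul0r.
Qed.

(** * The remainder of the expansion *)

Variable D : set M.
Hypotheses (oD : open D) (DU : D `<=` U) (D0 : forall q, D q -> 0 < rho q)
  (nD : \forall s \near 0^'+, D (expn x s)).

Lemma asym_eq_on n F G l : (forall q, D q -> F q = G q) -> asym n G l ->
  asym n F l.
Proof.
move=> FG; apply: asym_eq; apply: filterS nD => s Ds; exact: esym (FG _ Ds).
Qed.

Lemma asym0D n F G : asym n F 0 -> asym n G 0 -> asym n (fun q => F q + G q) 0.
Proof. by move=> aF aG; rewrite -[X in asym _ _ X](addr0 0); exact: asymD. Qed.

Lemma asym0M m n F G l : asym m F l -> asym n G 0 ->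
  asym (m + n) (fun q => F q * G q) 0.
Proof. by move=> aF aG; rewrite -[X in asym _ _ X](mulr0 l); exact: asymM. Qed.

Lemma asym0Ms n F G : smooth_at F x -> asym n G 0 ->
  asym n (fun q => F q * G q) 0.
Proof. move=> sF aG; exact: asym0M (asym_smooth sF) aG. Qed.

Lemma smooth_on_rholn : smooth_on D (fun q => ln (rho q)).
Proof.
by move=> q Dq; apply: smooth_at_ln; [exact: D0|apply: srho; exact: DU].
Qed.

(** The terms [l rho^5 log rho + h rho^5] and their derivatives; the coefficients
    are arbitrary functions so that the class is stable under differentiation. *)
Definition log_term n F := exists a b, [/\ smooth_on U a, smooth_on U b &
  forall q, D q -> F q = a q * rho q ^+ n * ln (rho q) + b q * rho q ^+ n].

Lemma vfield_eq_D X F G p : vfield U X -> D p -> (forall q, D q -> F q = G q) ->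
  smooth_at G p -> X F p = X G p.
Proof.
move=> vX Dp FG sG; apply/esym/(vfield_near_eq vX (DU Dp) sG).
by apply: filterS (near_open oD Dp) => q Dq; exact: esym (FG q Dq).
Qed.

Lemma smooth_log_term n F : log_term n F -> smooth_on D F.
Proof.
move=> [a [b [sa sb FE]]] p Dp; have Up := DU Dp.
apply: (@smooth_at_near_eq _ _ (fun q => a q * rho q ^+ n * ln (rho q) + b q * rho q ^+ n)).
  by apply: filterS (near_open oD Dp) => q Dq; exact: esym (FE q Dq).
have sL := smooth_on_rholn Dp; have sap := sa p Up; have sbp := sb p Up.
by smoothP.
Qed.

Lemma log_term_vfield X n F : vfield U X -> (forall q, U q -> X rho q = 0) ->
  log_term n F -> log_term n (X F).
Proof.
move=> vX Xr [a [b [sa sb FE]]]; exists (X a), (X b).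
split; [move=> q Uq; exact: (vfield_smooth oU vX Uq (sa q Uq))|
  move=> q Uq; exact: (vfield_smooth oU vX Uq (sb q Uq))|].
move=> p Dp; have Up := DU Dp.
have sL := smooth_on_rholn Dp; have sap := sa p Up; have sbp := sb p Up.
rewrite (vfield_eq_D vX Dp FE); last by smoothP.
deriv vX; rewrite (vfield_ln vX Up (srho Up) (D0 Dp)) Xr//; ring.
Qed.

Lemma log_term_e2 n F : log_term n.+1 F -> log_term n (e2 F).
Proof.
move=> [a [b [sa sb FE]]].
exists (fun q => e2 a q * rho q + n.+1%:R * a q),
  (fun q => a q + e2 b q * rho q + n.+1%:R * b q).
split=> [q Uq|q Uq|p Dp].
- by have saq := sa q Uq; smoothP.
- by have saq := sa q Uq; have sbq := sb q Uq; smoothP.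
have Up := DU Dp.
have sL := smooth_on_rholn Dp; have sap := sa p Up; have sbp := sb p Up.
rewrite (vfield_eq_D v2 Dp FE); last by smoothP.
deriv v2; rewrite (vfield_ln v2 Up (srho Up) (D0 Dp)) e2_rho//= exprS.
by field; rewrite gt_eqF ?D0.
Qed.

Lemma asym_log_term n F : log_term n.+1 F -> asym n F 0.
Proof.
move=> [a [b [sa sb FE]]]; have ar := asym_rho.
have an : asym n (fun q => rho q ^+ n) 1.
  apply: cvg_near_cst; apply: filterS near_lt_len => s sx.
  by rewrite rho_geodesic// divff// expf_neq0// gt_eqF//; case/andP: sx.
apply: (asym_eq_on (G := fun q => a q * (rho q ^+ n * (rho q * ln (rho q)))
    + b q * (rho q ^+ n * rho q))).
  by move=> q Dq; rewrite FE// exprS; ring.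
apply: asym0D; apply: asym0Ms; [exact: (sa x Ux)| |exact: (sb x Ux)|].
  by have := asym0M an asym_rho_ln; rewrite addn0.
have ar0 : asym 0 rho 0 by exact: asym_low ar.
by have := asym0M an ar0; rewrite addn0.
Qed.

(** The part of [e1] and of [T] tangent to the level sets of [rho]. *)
Let t1 := vadd e1 (vopp (vscale (e1 rho) e2)).
Let t0 := vadd T (vopp (vscale (T rho) e2)).

Let vt1 : vfield U t1.
Proof.
apply: vfield_vadd => //; apply/vfield_vopp/vfield_vscale => //.
by move=> q Uq; smoothP.
Qed.
Let vt0 : vfield U t0.
Proof.
apply: vfield_vadd => //; apply/vfield_vopp/vfield_vscale => //.
by move=> q Uq; smoothP.
Qed.
Let t1rho q : U q -> t1 rho q = 0.
Proof. by move=> Uq; rewrite /t1 /vadd /vopp /vscale e2_rho// mulr1 subrr. Qed.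
Let t0rho q : U q -> t0 rho q = 0.
Proof. by move=> Uq; rewrite /t0 /vadd /vopp /vscale e2_rho// mulr1 subrr. Qed.

Lemma e1_decomposition y q : D q -> e1 y q = t1 y q + e1 rho q * e2 y q.
Proof. by move=> _; rewrite /t1 /vadd /vopp /vscale subrK. Qed.

(** The estimates on the expansion are for fields annihilating [rho] applied after
    derivatives along [e2]. The commutator of [e2] and [e1] brings [e1 e1] to this
    form, at the price of the field [t0]. *)
Lemma e1_e1_decomposition y q : D q -> smooth_on D y ->
  e1 (e1 y) q = t1 (t1 y) q + t1 (e1 rho) q * e2 y q
    + 2 * (e1 rho q * t1 (e2 y) q)
    + e1 rho q * (e1 rho q * e2 (e2 y) q
      + omega e1 q * (t1 y q + e1 rho q * e2 y q)
      + 2 * (t0 y q + T rho q * e2 y q)).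
Proof.
move=> Dq sy; have Uq := DU Dq; have syq := sy q Dq.
have st1 : smooth_at (t1 y) q by exact: (vfield_smooth oU vt1 Uq syq).
have s2y : smooth_at (e2 y) q by smoothP.
have s1r : smooth_at (e1 rho) q by smoothP.
rewrite e1_decomposition//.
rewrite (vfield_eq_D vt1 Dq (fun p => @e1_decomposition y p)); last by smoothP.
rewrite (vfieldD vt1 Uq st1 (smooth_atM s1r s2y)) (vfieldM vt1 Uq s1r s2y).
have -> : e2 (e1 y) q = e1 (e2 y) q + omega e1 q * e1 y q + 2 * T y q.
  by rewrite comm_e1_e2//; ring.
rewrite (@e1_decomposition (e2 y))// (@e1_decomposition y)//.
have -> : T y q = t0 y q + T rho q * e2 y q.
  by rewrite /t0 /vadd /vopp /vscale subrK.
ring.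
Qed.

Variables u l h : M -> R.
Hypothesis hu : formal_solution U e1 e2 rho expn len omega Rc u v w z l h.
Hypothesis su : smooth_on D u.

Let sl : smooth_on U l. Proof. by have [_ _ _ []] := fs_coefficients hu. Qed.
Let sh : smooth_on U h. Proof. by have [_ _ _ _ []] := fs_coefficients hu. Qed.

Let k q := l q * rho q ^+ 5 * ln (rho q) + h q * rho q ^+ 5.
Let r q := u q - expansion rho v w z l h q.
Let rem q := u q - P q.

Let remE q : rem q = k q + r q.
Proof. by rewrite /rem /k /r /expansion /P /polynomial_part; ring. Qed.

Let logk : log_term 5 k. Proof. by exists l, h. Qed.
Let sk : smooth_on D k. Proof. exact: smooth_log_term logk. Qed.
Let sP : smooth_on D P.
Proof. by move=> q /DU Uq; exact: (smooth_polynomial_part Uq). Qed.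
Let srem : smooth_on D rem.
Proof. by move=> q Dq; apply: smooth_atB; [exact: (su Dq)|exact: (sP Dq)]. Qed.
Let sr : smooth_on D r.
Proof.
have E : r = fun q => rem q - k q by apply/funext => q; rewrite remE addrC addKr.
by rewrite E => q Dq; apply: smooth_atB; [exact: (srem Dq)|exact: (sk Dq)].
Qed.

Lemma remainder_bound (Xs : seq (op M)) b m :
  (forall j, (j < size Xs)%N -> vfield U (nth (@vzero R M) Xs j) /\
     forall q, U q -> nth (@vzero R M) Xs j rho q = 0) ->
  (b <= 6)%N -> (m < 6 - b)%N -> asym m (foldr (fun X f => X f) (iter b e2 r) Xs) 0.
Proof.
move=> HX b6 mb; have [C HC] := fs_expansion hu Ux bx b HX.
apply: (@asym_bound m (6 - b) _ C) => //.
have := near_geodesic_gt0 HC; have := near_lt_len.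
by apply: filterS2 => s sx /=; rewrite rho_geodesic// subzn.
Qed.

(** The remainder has an explicit part and a part that is only estimated; each
    differentiation has to be split accordingly. *)
Lemma split_vfield X F G H : vfield U X -> (forall q, D q -> F q = G q + H q) ->
  smooth_on D G -> smooth_on D H ->
  [/\ forall q, D q -> X F q = X G q + X H q, smooth_on D (X G) & smooth_on D (X H)].
Proof.
move=> vX FE sG sH; split=> q Dq; have Uq := DU Dq.
- rewrite (vfield_eq_D vX Dq FE); last by apply: smooth_atD; [exact: (sG q Dq)|exact: (sH q Dq)].
  exact: (vfieldD vX Uq (sG q Dq) (sH q Dq)).
- exact: (vfield_smooth oU vX Uq (sG q Dq)).
- exact: (vfield_smooth oU vX Uq (sH q Dq)).
Qed.

Let low m n F : (m < n)%N -> asym n F 0 -> asym m F 0.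
Proof. exact: asym_low. Qed.

Lemma remainder_asym :
  [/\ asym 3 rem 0, asym 3 (e2 rem) 0, asym 3 (t1 rem) 0 & asym 2 (t0 rem) 0] /\
  [/\ asym 2 (e2 (e2 rem)) 0, asym 2 (t1 (t1 rem)) 0 & asym 2 (t1 (e2 rem)) 0].
Proof.
have [E2 s2k s2r] := split_vfield v2 (fun q _ => remE q) sk sr.
have [E22 _ _] := split_vfield v2 E2 s2k s2r.
have [E1 s1k s1r] := split_vfield vt1 (fun q _ => remE q) sk sr.
have [E11 _ _] := split_vfield vt1 E1 s1k s1r.
have [E12 _ _] := split_vfield vt1 E2 s2k s2r.
have [E0 _ _] := split_vfield vt0 (fun q _ => remE q) sk sr.
have l2 := log_term_e2 logk; have l22 := log_term_e2 l2.
have l1 := log_term_vfield vt1 t1rho logk; have l11 := log_term_vfield vt1 t1rho l1.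
have l12 := log_term_vfield vt1 t1rho l2; have l0 := log_term_vfield vt0 t0rho logk.
have H0 : forall j, (j < size (@nil (op M)))%N -> vfield U (nth (@vzero R M) [::] j) /\
  forall q, U q -> nth (@vzero R M) [::] j rho q = 0 by [].
have H1 : forall j, (j < size [:: t1])%N -> vfield U (nth (@vzero R M) [:: t1] j) /\
  forall q, U q -> nth (@vzero R M) [:: t1] j rho q = 0 by case.
have HT : forall j, (j < size [:: t0])%N -> vfield U (nth (@vzero R M) [:: t0] j) /\
  forall q, U q -> nth (@vzero R M) [:: t0] j rho q = 0 by case.
have H2 : forall j, (j < size [:: t1; t1])%N ->
  vfield U (nth (@vzero R M) [:: t1; t1] j) /\
  forall q, U q -> nth (@vzero R M) [:: t1; t1] j rho q = 0 by case=> [|[|]].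
split; split.
- apply: (asym_eq_on (fun q _ => remE q)); apply: asym0D.
    exact: low (asym_log_term logk).
  exact: (@remainder_bound [::] 0 3 H0 isT isT).
- apply: (asym_eq_on E2); apply: asym0D; first exact: asym_log_term l2.
  exact: (@remainder_bound [::] 1 3 H0 isT isT).
- apply: (asym_eq_on E1); apply: asym0D; first exact: low (asym_log_term l1).
  exact: (@remainder_bound [:: t1] 0 3 H1 isT isT).
- apply: (asym_eq_on E0); apply: asym0D; first exact: low (asym_log_term l0).
  exact: (@remainder_bound [:: t0] 0 2 HT isT isT).
- apply: (asym_eq_on E22); apply: asym0D; first exact: asym_log_term l22.
  exact: (@remainder_bound [::] 2 2 H0 isT isT).
- apply: (asym_eq_on E11); apply: asym0D; first exact: low (asym_log_term l11).
  exact: (@remainder_bound [:: t1; t1] 0 2 H2 isT isT).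
- apply: (asym_eq_on E12); apply: asym0D; first exact: low (asym_log_term l12).
  exact: (@remainder_bound [:: t1] 1 2 H1 isT isT).
Qed.

Lemma asym_e1_remainder : asym 3 (e1 rem) 0.
Proof.
have [[_ a2' a1' _] _] := remainder_asym.
apply: (asym_eq_on (fun q => @e1_decomposition rem q)); apply: asym0D => //.
by apply: asym0Ms => //; smoothP.
Qed.

Lemma asym_e1_e1_remainder : asym 2 (e1 (e1 rem)) 0.
Proof.
have [[_ a2' a1' a0'] [a22 a11 a12]] := remainder_asym.
have a2l : asym 2 (e2 rem) 0 by exact: low a2'.
have a1l : asym 2 (t1 rem) 0 by exact: low a1'.
apply: (asym_eq_on (fun q Dq => @e1_e1_decomposition rem q Dq srem)).
have s1r : smooth_at (e1 rho) x by smoothP.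
have st : smooth_at (t1 (e1 rho)) x by exact: (vfield_smooth oU vt1 Ux s1r).
have sT : smooth_at (T rho) x by smoothP.
have sA' : smooth_at (omega e1) x by smoothP.
have s2 : smooth_at (fun=> 2 : R) x by exact: smooth_at_cst.
by repeat first [assumption|apply: asym0D|apply: (asym0Ms s1r)|apply: (asym0Ms st)
  |apply: (asym0Ms sT)|apply: (asym0Ms sA')|apply: (asym0Ms s2)].
Qed.

Lemma asym_defect_u : asym 3 (defect u) 0.
Proof.
have [C HC] := fs_equation hu Ux bx.
have HC' := near_geodesic_gt0 HC.
have a : asym 4 (fun q => rho q ^+ 4 * (rho q * ln (rho q))) 0.
  have a4 : asym 4 (fun q => rho q ^+ 4) 1.
    apply: cvg_near_cst; apply: filterS near_lt_len => s sx.
    by rewrite rho_geodesic// divff// expf_neq0// gt_eqF//; case/andP: sx.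
  by have := asym0M a4 asym_rho_ln.
have {}a := asym0Ms (smooth_at_cst C (p := x)) (low (isT : (3 < 4)%N) a).
apply/cvgr0Pnorm_lt => e e0; have /cvgr0_norm_lt/(_ e e0) := a.
apply: filterS3 HC' near_lt_len => s Hs sx; apply: le_lt_trans.
rewrite !normrM ler_wpM2r//.
have s0 : 0 < s by case/andP: sx.
apply: (le_trans Hs); rewrite /= rho_geodesic// (gtr0_norm s0).
have -> : s * (s * (s * s)) * (s * `|ln s|) = s ^+ 5 * `|ln s| by ring.
by rewrite ler_wpM2r ?ler_norm// mulr_ge0// exprn_ge0// (ltW s0).
Qed.

(** [defect] is quadratic, so that passing from [u] to [P] costs [O(rho)] times
    second derivatives of the remainder, and bounded functions times its first
    derivatives. *)
Lemma asym_defect_P : asym 3 (defect P) 0.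
Proof.
have [[arem a2' a1' a0'] [a22 a11 a12]] := remainder_asym.
have ae1 := asym_e1_remainder; have ae11 := asym_e1_e1_remainder.
have uE q : D q -> u q = P q + rem q by move=> _; rewrite /rem addrC subrK.
have [E1 s1P s1r] := split_vfield v1 uE sP srem.
have [E11 _ _] := split_vfield v1 E1 s1P s1r.
have [E2 s2P s2r] := split_vfield v2 uE sP srem.
have [E22 _ _] := split_vfield v2 E2 s2P s2r.
pose lap q := e1 (e1 rem) q + e2 (e2 rem) q + (fun q => - omega e1 q) q * e2 rem q.
pose K q := (fun=> 2) q * (e1 P q * e1 rem q) + e1 rem q * e1 rem q
  + ((fun=> 2) q * (e2 P q * e2 rem q) + e2 rem q * e2 rem q)
  + (fun=> - 2^-1) q * (P q * lap q + (laplP e1 e2 omega P q * rem q + rem q * lap q))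
  + (fun q => - 8^-1 * Rc q) q * ((fun=> 2) q * (P q * rem q) + rem q * rem q).
have defE q : D q -> defect P q = defect u q + (fun=> -1) q * K q.
  move=> Dq; have Uq := DU Dq; rewrite /defect /dP_normsq /laplP uE// E1// E2// E11// E22//.
  by rewrite /K /lap /laplP omega_e2//; field.
have sPx : smooth_at P x := smooth_polynomial_part Ux.
have s1x : smooth_at (e1 P) x by smoothP.
have s2x : smooth_at (e2 P) x by smoothP.
have sNA : smooth_at (fun q => - omega e1 q) x by smoothP.
have sNR : smooth_at (fun q => - 8^-1 * Rc q) x by smoothP.
have sLP : smooth_at (laplP e1 e2 omega P) x.
  have so2 : smooth_at (omega e2) x by exact: (form_smooth cff oU subU v2).
  by rewrite /laplP; smoothP.
have sc (a : R) : smooth_at (fun=> a) x by exact: smooth_at_cst.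
have l3 F : asym 3 F 0 -> asym 0 F 0 by exact: low.
have l2 F : asym 3 F 0 -> asym 2 F 0 by exact: low.
have alap : asym 2 lap 0.
  apply: asym0D; first exact: asym0D.
  by apply: (asym0Ms sNA); exact: l2.
have aP1 : asym 1 P 1.
  have aN : asym 0 (fun q => 1 + v q * rho q + w q * rho q ^+ 2 + z q * rho q ^+ 3) 1.
    have sN : smooth_at (fun q => 1 + v q * rho q + w q * rho q ^+ 2 + z q * rho q ^+ 3) x.
      by smoothP.
    have := asym_smooth sN.
    by rewrite (rho_boundary Ux bx) !expr0n !mulr0 !addr0.
  have := asymM asym_rho aN; rewrite mulr1; apply: asym_eq_on => q Dq.
  by rewrite /P /polynomial_part; ring.
have aPlap : asym 3 (fun q => P q * lap q) 0 := asym0M aP1 alap.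
have aremlap : asym 3 (fun q => rem q * lap q) 0.
  have a1rem : asym 1 rem 0 by exact: low arem.
  exact: asym0M a1rem alap.
have sq F : asym 3 F 0 -> asym 3 (fun q => F q * F q) 0.
  by move=> aF; exact: (asym0M (l3 _ aF) aF).
apply: (asym_eq_on defE); apply: asym0D; first exact: asym_defect_u.
apply: (asym0Ms (sc _)).
repeat first [assumption|apply: asym0D|apply: (asym0Ms (sc _))|apply: sq
  |apply: (asym0Ms sNR)|apply: (asym0Ms s1x)|apply: (asym0Ms s2x)|apply: (asym0Ms sPx)
  |apply: (asym0Ms sLP)].
Qed.

End Asymptotics.

Lemma defect_polynomial_part u l h y :
  formal_solution U e1 e2 rho expn len omega Rc u v w z l h ->
  U y -> boundary y -> forall j, (j <= 3)%N -> iter j e2 (defect P) y = 0.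
Proof.
move=> hu Uy by'; have := fs_smooth hu Uy by'.
move=> /(conj (near_open oU Uy)) [nU nu].
have : nbhs y [set q | U q /\ (0 < rho q -> smooth_at u q)].
  by apply: filterS2 nU nu.
rewrite nbhsE => -[A [oA Ay] AU].
(* [u] is not smooth on the boundary: the asymptotics are taken in [rho > 0]. *)
pose D := A `&` [set q | 0 < rho q].
have oD : open D.
  rewrite openE => q [Aq q0]; apply: filterI; first exact: open_nbhs_nbhs.
  apply: cvgr_gt q0; apply: smooth_at_continuous; apply: srho.
  by case: (AU q Aq).
have DU : D `<=` U by move=> q [/AU[]].
have D0 q : D q -> 0 < rho q by case.
have nD : \forall s \near 0^'+, D (expn y s).
  apply: filterS2 (near_geodesic Uy by' (near_open oA Ay)) (near_lt_len Uy by').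
  by move=> s As sx; split=> //=; rewrite rho_geodesic//; case/andP: sx.
have su : smooth_on D u by move=> q [/AU[_ uq] /uq].
have aP := asym_defect_P Uy by' oD DU D0 nD hu su.
apply: (asym0_iter Uy by' _ aP) => q Uq.
have sPq := smooth_polynomial_part Uq.
have so2 : smooth_at (omega e2) q by exact: (form_smooth cff oU subU v2).
by rewrite /defect /dP_normsq /laplP; smoothP.
Qed.

(** * The coefficient *)

Variables u l h : M -> R.
Hypothesis hu : formal_solution U e1 e2 rho expn len omega Rc u v w z l h.

(** The first [e2]-derivative of the defect of [P] is [3 v + omega(e1) / 2]. *)
Lemma omega1_boundary y : U y -> boundary y -> omega e1 y = - 6 * v y.
Proof.
move=> Uy by'; have [cf jf] := jet_e1_rho Uy by'.
have [cB jB] := jet_e1_e1_rho Uy by'; have [cA jA] := jet_omega1 Uy by'.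
have [_ [_ E _ _]] := jet_defect Uy by' jf jB jA (jet_self y sRc).
have := defect_polynomial_part hu Uy by' (isT : (1 <= 3)%N); rewrite /= E => E1.
apply/eqP; rewrite -subr_eq0; apply/eqP.
by rewrite -[RHS](mulr0 2) -E1; field.
Qed.

(** The second [e2]-derivative of the defect of [P] determines [w], which the third
    then eliminates; [e1 (omega e1) = - 6 e1 v] because [e1] is tangent to the
    boundary. *)
Lemma coefficient_of_rho4 x : U x -> boundary x ->
  12 * z x =
    3 * e1 (e1 v) x
    - 12 * Vfield T e2 alpha alpha x
    - 3 / 4 * e2 Rc x
    + 15 / 2 * Rc x * v x
    + 18 * alpha x * e1 v x
    + 56 * v x * e1 alpha x
    + 264 * v x ^+ 3
    + 40 * alpha x ^+ 2 * v x
    - 6 * a1 x * alpha x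
    - 10 * a2 x * v x
    - 6 * e1 a1 x
    + 3 * e2 a2 x.
Proof.
move=> Ux bx; have [cf jf] := jet_e1_rho Ux bx.
have [cB jB] := jet_e1_e1_rho Ux bx; have [cA jA] := jet_omega1 Ux bx.
have [_ [_ _ E2 E3]] := jet_defect Ux bx jf jB jA (jet_self x sRc).
have H2 := defect_polynomial_part hu Ux bx (isT : (2 <= 3)%N).
have H3 := defect_polynomial_part hu Ux bx (isT : (3 <= 3)%N).
rewrite /= in H2 H3; rewrite {}E2 in H2; rewrite {}E3 in H3.
have e1A : e1 (omega e1) x = - 6 * e1 v x.
  have sF : smooth_at (fun q => omega e1 q + 6 * v q) x by smoothP.
  have := e1_boundary Ux bx sF; deriv v1 => H.
  have /eqP : e1 (omega e1) x + (0 * v x + 6 * e1 v x) = 0.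
    by apply: H => y Uy by'; rewrite omega1_boundary//; ring.
  by rewrite mul0r add0r addr_eq0 mulNr => /eqP.
move: H2 H3; rewrite e1A omega1_boundary// omegaT_boundary// => H2 H3.
have w3 : w x = 3^-1 * (- 12 * v x ^+ 2 - 4 * alpha x ^+ 2 - 2 * e1 alpha x
    - 3 / 8 * Rc x + a2 x).
  apply/eqP; rewrite -subr_eq0; apply/eqP.
  by rewrite -[RHS](mulr0 6^-1) -H2; field.
apply/eqP; rewrite -subr_eq0; apply/eqP.
by rewrite -[RHS](mulr0 1) -H3 w3; field.
Qed.

End Frame.

Theorem proposition18 (R : realType) (M : bmanifold3 R)
    (S : pseudohermitian M) (T : op M) (hT : is_reeb S T)
    (nabla : op M -> op M -> op M) (hnabla : is_tanaka_webster S T nabla)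
    (U : set M) (e1 e2 : op M) (rho : M -> R) (expn : M -> R -> M)
    (len : M -> R) (hF : adapted_frame S T nabla U e1 e2 rho expn len)
    (omega : op M -> M -> R)
    (homega : is_connection_form nabla U e1 e2 omega)
    (a1 a2 : M -> R) (ha : torsion_coefficients T nabla U e1 e2 a1 a2)
    (W : M -> R) (hW : webster_curvature U e1 e2 omega W)
    (Rc : M -> R) (hRc : forall p, U p -> Rc p = 2 * W p)
    (alpha : M -> R) (halpha : is_alpha T U e2 alpha)
    (u v w z l h : M -> R)
    (hu : formal_solution U e1 e2 rho expn len omega Rc u v w z l h)
    (x : M) (hxU : U x) (hx : boundary x) :
  12 * z x =
    3 * e1 (e1 v) x
    - 12 * Vfield T e2 alpha alpha x
    - 3 / 4 * e2 Rc x
    + 15 / 2 * Rc x * v x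
    + 18 * alpha x * e1 v x
    + 56 * v x * e1 alpha x
    + 264 * v x ^+ 3
    + 40 * alpha x ^+ 2 * v x
    - 6 * a1 x * alpha x
    - 10 * a2 x * v x
    - 6 * e1 a1 x
    + 3 * e2 a2 x.
Proof.
have [bv bw bz _ _] := fs_coefficients hu.
exact: (coefficient_of_rho4 hT hnabla hF homega ha hW hRc halpha bv bw bz hu
  hxU hx).
Qed.
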